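(* There is an absolute constant $c>0$ such that for every integer $n\geq 5$, with $N=2^n-1$, $R=\mathbb{Z}/N\mathbb{Z}$ and $w_n=\lfloor n/2+\sqrt n\rfloor$, \[ \sum_{t\in R,\ t\neq 0}\left|\widehat{S_{w_n}}(t)\right|^4\geq c\,n^{-3}. \] In particular, \[ E(S_{w_n})-\frac{|S_{w_n}|^4}{N}\asymp N^3n^{-3}, \] that is, there are absolute constants $0<c_1\leq c_2$ such that $c_1N^3n^{-3}\leq E(S_{w_n})-|S_{w_n}|^4/N\leq c_2N^3n^{-3}$ for all $n\geq 5$.
   Context: For an integer $n\geq 3$ put $N=2^n-1$ and $R=\mathbb{Z}/N\mathbb{Z}$ (neither $n$ nor $N$ is assumed prime). Each residue in $R$ is identified with its representative in $\{0,\ldots,2^n-2\}$, and $\mathrm{wt}(x)$ denotes the number of ones in the $n$-digit binary expansion of that representative. For $w\in\{0,\ldots,n-1\}$, $S_w=\{x\in R:\mathrm{wt}(x)=w\}$, so $|S_w|=\binom{n}{w}$. The Fourier transform is normalized as \[ \widehat{S_w}(t)=\frac1N\sum_{x\in S_w}\exp\left(-\frac{2\pi i\,xt}{N}\right),\qquad t\in R. \] For $A\subseteq R$, the additive energy is $E(A)=\left|\{(a,b,c,d)\in A^4: a+b=c+d\}\right|$, with addition in $R$. *)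

(* Defs.v *)
From mathcomp Require Import all_boot all_order all_algebra.
From mathcomp Require Import reals trigo.
From mathcomp Require Export complex.

Set Implicit Arguments.
Unset Strict Implicit.
Unset Printing Implicit Defensive.

Import GRing.Theory Num.Theory.
Import ComplexField.

Local Open Scope ring_scope.
Local Open Scope complex_scope.

Definition mersenne (n : nat) : nat := (2 ^ n - 1)%N.

(* For 3 <= n the modulus exceeds 1, so this is Z/(2^n-1)Z, and the underlying
   nat of an element is its representative in {0, ..., 2^n - 2}. *)
Definition residue (n : nat) := 'Z_(mersenne n).

Definition wt (n : nat) (x : residue n) : nat :=
  #|[set i : 'I_n | odd (x %/ 2 ^ i)%N]|.

Definition weight_class (n w : nat) : {set residue n} := [set x | wt x == w].

(* exp(i * theta) for real theta. *)
Definition expi (R : realType) (theta : R) : R[i] := cos theta +i* sin theta.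

Definition fourier (R : realType) (n : nat) (A : {set residue n})
    (t : residue n) : R[i] :=
  ((mersenne n)%:R)^-1 *
  \sum_(x in A)
     expi (- (2 * pi * (x : nat)%:R * (t : nat)%:R / (mersenne n)%:R)).

(* The real-valued modulus on R[i]; the generic norm there takes values in R[i]. *)
Definition modulus (R : realType) (z : R[i]) : R := Normc.normc z.

Definition energy (n : nat) (A : {set residue n}) : nat :=
  #|[set q : residue n * residue n * residue n * residue n |
      let: (a, b, c, d) := q in
      [&& a \in A, b \in A, c \in A, d \in A & a + b == c + d]]|.

(* floor(n/2 + sqrt n); the floor is nonnegative, so taking the absolute value
   only converts it from int to nat. *)
Definition shifted_weight (R : realType) (n : nat) : nat :=
  `|Num.floor (n%:R / 2 + Num.sqrt n%:R : R)|%N.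

(* Main.v *)
Require Import Defs.
From mathcomp Require Import all_boot all_order all_algebra.
From mathcomp Require Import topology normedtype.
From mathcomp Require Import reals sequences trigo exp realfun derive.
From mathcomp Require Import ring lra zify.

Set Implicit Arguments.
Unset Strict Implicit.
Unset Printing Implicit Defensive.

Import numFieldNormedType.Exports.
Import Order.TTheory GRing.Theory Num.Theory.
Import ComplexField.
Local Open Scope ring_scope.
Local Open Scope complex_scope.

(** Put x_t = pi t / N and, for m = n + 1, phi_k = pi k / m. A residue of digit
    sum w < n is a set of w positions in {0, ..., n - 1}, and detecting w by the
    m-th roots of unity gives (fourier_weight_class)
    << S_w^(t) = 1/N 1/m sum_k e(- k w / m) prod_(j < n) (1 + e(k / m) e(- 2^j t / N)) >>
    where the j-th factor has modulus 2 |cos (2^j x_t - phi_k)|. Write H(x, phi)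
    for the product of the fourth powers of these cosines (cos4prod). Since
    energy minus main term is N^3 times the fourth moment over t != 0
    (energy_excess), everything reduces to two-sided bounds of order n^(-3) for
    that moment.

    Upper bound. The core is an estimate, with s = sin phi, of the form
    << sum_(t != 0) H(x_t, phi) <= C n (s^4 (1 - s^2 / 8)^n + (8/27)^n) >>
    (sum_cos4prod_le). The Gaussian factor comes from the sum over all t: there
    H has frequencies too small to interact with the modulus N, and two
    consecutive factors have mean at most (1 - s^2 / 4) / 4
    (fourth_sum_two_steps). The factor s^4 comes from the exclusion of t = 0:
    after a rotation t -> 2^j t of the digits one may assume that sin x_t is
    bounded below (exists_large_sin), which is the source of the factor n, and
    the identity sin y cos y = sin (2 y) / 2 makes the sine pass through the
    product, halving at each step and leaving an error s each time
    (sin4_cos4_le, sine_sum_le). For phi_k with k near 0 or m, s is of order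
    k' / n with k' the distance from k to 0 or m, so the fourth root of the
    estimate is n^(-1/4) times a function of width sqrt n in k'. Hoelder's
    inequality with the weights 1 / (1 + n s^2), whose sum is O(sqrt n), then
    gives a fourth moment of order (1/m)^4 (sqrt n)^4 / n, that is n^(-3)
    (sum_fourier4_le).

    Lower bound. The coefficients at t = 1, 2, 4, ..., 2^(n-1) have equal
    modulus (fourier_rotate), so it suffices that the one at 1 is at least c / n
    (modulus_fourier_unit_lower). Its imaginary part compares residues without
    the top digit with those that have it, and the latter see the opposite
    sine. Thus it is the difference of the sums of a nonnegative sine over sets
    of w - 1 and of w positions among n - 1; double counting of the pairs made
    of a set and one of its elements shows that this difference is at least the
    fraction (2 w - n) / (n - w) of the sum, up to a bounded error per set
    divided by n - w (shifted_sines_ge). For w = n/2 + sqrt n the fraction is of order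
    1 / sqrt n, and the sum is of order 2^n / sqrt n because binomial
    coefficients at distance sqrt n from the middle are comparable to the
    central one (binomial_near_middle_ge). This argument needs n large; for the
    finitely many remaining n the moment is positive since the weight class is
    neither empty nor everything (fourier4_pos). *)

(** * Elementary inequalities *)

Section Trig.
Variable R : realType.
Implicit Types a b x y : R.

Lemma sin_mean_value a b : a <= b ->
  exists2 c, a <= c <= b & sin b - sin a = cos c * (b - a).
Proof.
move=> ab.
have [|c cab ->] := @MVT_segment R sin cos a b ab.
  by apply: continuous_subspaceT => y; exact: continuous_sin.
by exists c => //; rewrite in_itv in cab.
Qed.

Lemma sin_lipschitz a b : `|sin b - sin a| <= `|b - a|.
Proof.
wlog ab : a b / a <= b.
  move=> wl; case: (leP a b) => [/wl//|/ltW/wl]; by rewrite distrC (distrC a).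
have [c _ ->] := sin_mean_value ab.
by rewrite normrM ler_piMl// cos_max.
Qed.

(** Since cos is decreasing on [0, pi], the mean value theorem gives
    y cos y <= sin y; with y = x / 2 this yields
    sin x = 2 sin y cos y >= 2 y (cos y)^2 = y (1 + cos x) >= y. *)
Lemma half_le_sin x : 0 <= x <= pi / 2 -> x / 2 <= sin x.
Proof.
move=> /andP[x0 xpi]; have pi0 := pi_gt0 R.
have x20 : 0 <= x / 2 by lra.
have [c /andP[c0 cx]] := sin_mean_value x20.
rewrite sin0 !subr0 => sx2.
have cosx : 0 <= cos x by apply: cos_ge0_pihalf; lra.
have cosx2 : 0 <= cos (x / 2) by apply: cos_ge0_pihalf; lra.
have cosc : cos (x / 2) <= cos c.
  rewrite leNgt ltr_cos ?in_itv/=; [rewrite -leNgt//|lra|lra].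
have xE : x = (x / 2) *+ 2 by rewrite -mulr_natr; field.
rewrite {2}xE sin_mulr2n sx2.
move: cosx; rewrite {1}xE cos_mulr2n => cosx.
have pq : 1 <= (cos (x / 2) * cos c) *+ 2 by nra.
by rewrite mulrA -mulrnAl ler_peMl.
Qed.

Lemma sin_abs_add a b : `|sin (a + b)| <= `|sin a| + `|sin b|.
Proof.
rewrite sinD (le_trans (ler_normD _ _))// lerD// normrM.
  by rewrite ler_piMr// cos_max.
by rewrite ler_piMl// cos_max.
Qed.

Lemma sinDpin a k : sin (a + pi *+ k) = (-1) ^+ k * sin a.
Proof. exact: (alternatingn (@sinDpi R)). Qed.

Lemma cosDpin a k : cos (a + pi *+ k) = (-1) ^+ k * cos a.
Proof. exact: (alternatingn (@cosDpi R)). Qed.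

Lemma sign4 k : ((-1) ^+ k) ^+ 4 = 1 :> R.
Proof. by rewrite -exprM mulnC exprM -signr_odd /= expr1n. Qed.

End Trig.

Lemma bernoulli_ge (R : realFieldType) (q : R) k : 0 <= q -> 1 + k%:R * q <= (1 + q) ^+ k.
Proof.
move=> q0; elim: k => [|k IH]; first by rewrite mul0r addr0 expr0.
have k0 := ler0n R k; rewrite exprS -natr1; nra.
Qed.

(** A rational substitute for exp (- k q) <= 1 / (1 + k q). *)
Lemma bernoulli_le (R : realFieldType) (q : R) k : 0 <= q <= 1 -> (1 - q) ^+ k * (1 + k%:R * q) <= 1.
Proof.
move=> /andP[q0 q1].
apply: (@le_trans _ _ ((1 - q) ^+ k * (1 + q) ^+ k)).
  by rewrite ler_wpM2l ?exprn_ge0 ?bernoulli_ge//; lra.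
have -> : (1 - q) ^+ k * (1 + q) ^+ k = (1 - q ^+ 2) ^+ k.
  by rewrite -exprMn; congr (_ ^+ k); ring.
have := sqr_ge0 q; have : q ^+ 2 <= 1 by rewrite expr_le1.
by move=> a b; rewrite exprn_ile1//; lra.
Qed.

(** A bound that holds from some unspecified index on extends to all indices
    when every term is positive, because only finitely many terms are left. *)
Lemma uniform_lower_bound (R : realFieldType) (X : nat -> R) (n1 n0 : nat) (c0 : R) :
  0 < c0 -> (forall n, (n1 <= n)%N -> 0 < X n) ->
  (forall n, (n1 <= n)%N -> (n0 <= n)%N -> c0 <= X n) ->
  exists2 c, 0 < c & forall n, (n1 <= n)%N -> c <= X n.
Proof.
move=> c0_gt0 X_gt0; elim: n0 c0 c0_gt0 => [|n0 IH] c0 c0_gt0 Xlarge.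
  by exists c0 => // n n1n; exact: Xlarge.
case: (leqP n1 n0) => [n10|n01]; last first.
  by apply: (IH c0) => // n n1n _; apply: Xlarge => //; exact: leq_trans n1n.
apply: (IH (Num.min c0 (X n0))) => [|n n1n]; first by rewrite lt_min c0_gt0 X_gt0.
rewrite leq_eqVlt => /orP[/eqP<-|n0n]; first by rewrite ge_min lexx orbT.
by rewrite ge_min Xlarge.
Qed.

Section PowerMean.
Variables (R : realFieldType) (I : finType) (u a : I -> R).

(** Hoelder's inequality with exponents 4 and 4/3. It is the sum of the
    tangent-line inequalities y^4 >= 4 A^3 y - 3 A^4 for y = a_i / u_i, where
    A is the u-average of these quotients. *)
Lemma weighted_power_mean : (forall i, 0 < u i) -> (forall i, 0 <= a i) ->
  (\sum_i a i) ^+ 4 <= (\sum_i u i) ^+ 3 * \sum_i a i ^+ 4 / u i ^+ 3.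
Proof.
move=> u0 a0; set U := \sum_i u i; set T := \sum_i a i.
have : 0 <= U by apply: sumr_ge0 => i _; exact: ltW.
rewrite le_eqVlt => /orP[U0|Ugt0].
  have T0 : T = 0.
    rewrite /T big1// => i _; exfalso.
    move: U0; rewrite eq_sym psumr_eq0 => [|j _]; last exact: ltW.
    by move=> /allP/(_ i); rewrite mem_index_enum => /(_ isT); rewrite gt_eqF.
  by rewrite T0 -(eqP U0) !expr0n /= mul0r.
set A := T / U.
have AU : A * U = T by rewrite /A divfK ?gt_eqF.
have A0 : 0 <= A by apply: divr_ge0; [exact: sumr_ge0|exact: ltW].
have : \sum_i (4 * A ^+ 3 * a i - 3 * A ^+ 4 * u i) <= \sum_i a i ^+ 4 / u i ^+ 3.
  apply: ler_sum => i _; set y := a i / u i.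
  have yE : a i = y * u i by rewrite /y divfK// gt_eqF.
  have -> : a i ^+ 4 / u i ^+ 3 = y ^+ 4 * u i.
    by rewrite yE; field; rewrite gt_eqF.
  have y0 : 0 <= y by apply: divr_ge0; [exact: a0|exact: ltW].
  rewrite yE mulrA -mulrBl ler_pM2r// -subr_ge0.
  have -> : y ^+ 4 - (4 * A ^+ 3 * y - 3 * A ^+ 4) =
     (y - A) ^+ 2 * (y ^+ 2 + 2 * A * y + 3 * A ^+ 2) by ring.
  by rewrite mulr_ge0 ?sqr_ge0//; nra.
rewrite sumrB -!mulr_sumr -/T -/U => le.
have := ler_wpM2l (exprn_ge0 3 (ltW Ugt0)) le; apply: le_trans.
by rewrite -AU le_eqVlt; apply/orP; left; apply/eqP; ring.
Qed.

End PowerMean.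

(** * Characters of the integers modulo 2^n - 1 *)

Section Expi.
Variable R : realType.
Implicit Types a b : R.

Lemma expi0 : expi 0 = 1 :> R[i].
Proof. by rewrite /expi cos0 sin0. Qed.

Lemma expiD a b : expi (a + b) = expi a * expi b.
Proof.
by rewrite /expi cosD (sinD a b) (addrC (sin a * cos b)).
Qed.

Lemma expiMn a k : expi (a *+ k) = expi a ^+ k.
Proof. by elim: k => [|k IH]; rewrite ?expi0// mulrS expiD IH exprS. Qed.

Lemma expiN a : expi (- a) = conjc (expi a).
Proof. by rewrite /expi cosN sinN. Qed.

Lemma normc_expi a : Normc.normc (expi a) = 1.
Proof. by rewrite /= cos2Dsin2 sqrtr1. Qed.

Lemma expi_2pi_int (q : int) : expi (2 * pi * q%:~R) = 1 :> R[i].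
Proof.
have nat_case k : expi (2 * pi * k%:R) = 1 :> R[i].
  by rewrite mulr_natr expiMn mulr_natl /expi cos2pi sin2pi expr1n.
case: q => k; first exact: nat_case.
by rewrite NegzE rmorphN /= mulrN expiN nat_case rmorph1.
Qed.

(** Reducing r modulo M to 0 < d < M leaves cos (2 pi d / M) =
    1 - 2 sin (pi d / M)^2, and the sine is positive. *)
Lemma expi_neq1 (M : nat) (r : int) : (0 < M)%N -> ~~ (M %| r)%Z ->
  expi (2 * pi * r%:~R / M%:R) != 1 :> R[i].
Proof.
move=> M_gt0 Mr; have M0 : 0 < M%:R :> R by rewrite ltr0n.
have Mz : 0 < M%:Z by rewrite ltz_nat.
set d := (r %% M)%Z.
have d0 : 0 < d.
  rewrite lt0r; apply/andP; split; last by rewrite modz_ge0 // gt_eqF.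
  by apply: contra Mr => /eqP d0; apply/dvdz_mod0P.
have dM : d < M by rewrite ltz_pmod.
have -> : 2 * pi * r%:~R / M%:R = 2 * pi * d%:~R / M%:R + 2 * pi * (r %/ M)%Z%:~R :> R.
  rewrite {1}(divz_eq r M) rmorphD rmorphM /= -/d; field.
  by rewrite gt_eqF.
rewrite expiD expi_2pi_int mulr1.
apply/negP => /eqP[cos1 _].
have : 0 < sin (pi * d%:~R / M%:R : R).
  apply: sin_gt0_pi; rewrite divr_gt0 ?mulr_gt0 ?pi_gt0 ?ltr0z//=.
  by rewrite ltr_pdivrMr// ltr_pM2l ?pi_gt0// -[M%:R]/(M%:~R) ltr_int.
have : 2 * pi * d%:~R / M%:R = (pi * d%:~R / M%:R) *+ 2 :> R.
  by rewrite -mulr_natl; field; rewrite gt_eqF.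
move: cos1 => /[swap] ->; rewrite cos_mulr2n cos2sin2 => sin0 sin_gt0.
nra.
Qed.

Lemma sum_expi (M : nat) (r : int) : (0 < M)%N ->
  \sum_(t < M) expi (2 * pi * r%:~R * t%:R / M%:R) =
  (if (M %| r)%Z then M%:R else 0) :> R[i].
Proof.
move=> M_gt0; have M0 : 0 < M%:R :> R by rewrite ltr0n.
have E t : expi (2 * pi * r%:~R * t%:R / M%:R) = expi (2 * pi * r%:~R / M%:R) ^+ t :> R[i].
  by rewrite -expiMn mulrAC mulr_natr.
under eq_bigr do rewrite E.
case: ifPn => [/dvdzP[q ->]|Mr].
  rewrite rmorphM /= mulrA mulfK ?gt_eqF// expi_2pi_int.
  under eq_bigr do rewrite expr1n.
  by rewrite sumr_const card_ord.
have := expi_neq1 M_gt0 Mr; rewrite -subr_eq0 => w1; apply: (mulfI w1).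
rewrite mulr0 -subrX1 -expiMn -(mulr_natr (_ / _)) divfK ?gt_eqF// expi_2pi_int.
by rewrite subrr.
Qed.

Lemma Re_sum (I : Type) (r : seq I) (P : pred I) (F : I -> R[i]) :
  complex.Re (\sum_(i <- r | P i) F i) = \sum_(i <- r | P i) complex.Re (F i).
Proof. by apply: (big_morph (@complex.Re R)) => // -[a b] [c d]. Qed.

End Expi.

Section Residues.
Variables (R : realType) (n : nat).
Hypothesis n_gt1 : (1 < n)%N.
Local Notation N := (mersenne n).

Lemma mersenne_gt1 : (1 < N)%N.
Proof. by rewrite /mersenne ltn_subRL (leq_trans _ (leq_pexp2l _ n_gt1)). Qed.

Lemma mersenneS : N.+1 = (2 ^ n)%N.
Proof. by rewrite /mersenne subn1 prednK// expn_gt0. Qed.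

Lemma mersenne_natr : N%:R + 1 = 2 ^+ n :> R.
Proof. by rewrite natr1 mersenneS natrX. Qed.

Lemma mersenne_pos : 0 < N%:R :> R.
Proof. by rewrite ltr0n ltnW // mersenne_gt1. Qed.

Lemma residue_lt (t : residue n) : (t < N)%N.
Proof. by rewrite (leq_trans (ltn_ord t))// Zp_cast// mersenne_gt1. Qed.

Lemma sum_residue (V : nmodType) (F : nat -> V) :
  \sum_(t : residue n) F t = \sum_(t < N) F t.
Proof.
rewrite -(big_mkord xpredT) -[RHS](big_mkord xpredT) Zp_cast//.
exact: mersenne_gt1.
Qed.

(** The point pi t / N. The factor 1 + e(theta) e(- 2^j t / N) has modulus
    2 |cos (pi theta - 2^j pi t / N)|, so halved angles are what occurs in the
    moduli of the transform. *)
Definition half_angle (t : nat) : R := pi * t%:R / N%:R.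

Lemma half_angleE t : half_angle t * N%:R = pi * t%:R.
Proof. by rewrite /half_angle divfK// gt_eqF// mersenne_pos. Qed.

Lemma sum_expi_residue (r : int) :
  \sum_(t : residue n) expi (2 * pi * r%:~R * t%:R / N%:R) =
  (if (N %| r)%Z then N%:R else 0) :> R[i].
Proof.
rewrite (sum_residue (fun t => expi (2 * pi * r%:~R * t%:R / N%:R : R))).
by rewrite sum_expi// ltnW// mersenne_gt1.
Qed.

Lemma sum_cos_residue (r : int) (a : R) : ~~ (N %| r)%Z ->
  \sum_(t : residue n) cos (2 * r%:~R * half_angle t + a) = 0.
Proof.
move=> Nr; have := sum_expi_residue r; rewrite (negPf Nr) => S0.
have E (t : residue n) : cos (2 * r%:~R * half_angle t + a) =
    complex.Re (expi (2 * pi * r%:~R * t%:R / N%:R) * expi a).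
  rewrite -expiD /=; congr (cos (_ + _)); rewrite /half_angle; field.
  by rewrite gt_eqF// mersenne_pos.
under eq_bigr do rewrite E.
by rewrite -Re_sum -mulr_suml S0 mul0r.
Qed.

(** Doubling permutes the residues because N is odd, and it changes
    pi t / N by a multiple of pi. *)
Lemma sum_double (F : R -> R) : (forall x, F (x + pi) = F x) ->
  \sum_(t : residue n) F (2 * half_angle t) = \sum_(t : residue n) F (half_angle t).
Proof.
move=> Fpi; have N0 := mersenne_pos.
have inj : injective (fun t : residue n => t *+ 2).
  have u2 : (2%:R : residue n) \is a GRing.unit.
    rewrite unitZpE ?mersenne_gt1// coprimen2 /mersenne oddB ?expn_gt0//.
    by rewrite oddX/=; case: (n) n_gt1.
  by move=> a b /=; rewrite -(mulr_natr a) -(mulr_natr b) => /(mulIr u2).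
rewrite [RHS](reindex_inj inj); apply: eq_bigr => t _.
have -> : nat_of_ord (t *+ 2) = ((t * 2) %% N)%N.
  by rewrite mulr2n /= muln2 -addnn; congr (_ %% _)%N; rewrite Zp_cast// mersenne_gt1.
have tN := residue_lt t.
case: (ltnP (t * 2) N) => h.
  by rewrite modn_small// /half_angle natrM; congr F; ring.
have -> : ((t * 2) %% N)%N = (t * 2 - N)%N.
  rewrite -[in LHS](subnK h) modnDr modn_small//.
  by rewrite ltn_subLR// muln2 -addnn; lia.
rewrite -[RHS]Fpi; congr F; rewrite /half_angle (natrB R h) natrM; field.
by rewrite gt_eqF.
Qed.

End Residues.

(** * Products of fourth powers of cosines *)

Section CosPowers.
Variable R : realType.
Implicit Types a b x phi : R.

Lemma cos_mul_cos4 a b : cos a * cos b ^+ 4 =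
  (6 * cos a + 4 * cos (a + 2 * b) + 4 * cos (a - 2 * b)
     + cos (a + 4 * b) + cos (a - 4 * b)) / 16.
Proof.
have c2 : cos (2 * b) = 2 * cos b ^+ 2 - 1 by rewrite mulr_natl cos_mulr2n mulr_natl.
have c4 : cos (4 * b) = 2 * cos (2 * b) ^+ 2 - 1.
  have -> : 4 * b = (2 * b) *+ 2 by ring.
  by rewrite cos_mulr2n [2 * _ ^+ 2]mulr_natl.
rewrite !(cosB a) !(cosD a) c4 c2; by field.
Qed.

(** Fourier expansion of two consecutive factors. The last parenthesis
    collects the frequencies in x that are not multiples of 8; these are the
    ones that vanish when the product is summed over residues against a
    function of 4 x. *)
Lemma cos4_mul_cos4 x phi :
  64 * (cos (x - phi) ^+ 4 * cos (2 * x - phi) ^+ 4) =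
  9 + 2 * cos (2 * phi) + 3 * cos (8 * x - 4 * phi) + 2 * cos (8 * x - 6 * phi)
  + (12 * cos (2 * x - 2 * phi) + 8 * cos (2 * x) + 12 * cos (4 * x - 2 * phi)
     + 3 * cos (4 * x - 4 * phi) + cos (4 * x) / 2 + 8 * cos (6 * x - 4 * phi)
     + 2 * cos (6 * x - 2 * phi) + 2 * cos (10 * x - 6 * phi)
     + cos (12 * x - 8 * phi) / 2).
Proof.
have e (y : R) : cos y ^+ 4 = (6 + 8 * cos (2 * y) + 2 * cos (4 * y)) / 16.
  have := cos_mul_cos4 0 y; rewrite cos0 !add0r !cosN !mul1r => ->; by field.
have prod (a b : R) : cos a * cos b = (cos (a + b) + cos (a - b)) / 2.
  by rewrite cosD cosB; field.
rewrite !e.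
set A := 2 * (x - phi); set B := 4 * (x - phi).
set C := 2 * (2 * x - phi); set D := 4 * (2 * x - phi).
have -> : 64 * ((6 + 8 * cos A + 2 * cos B) / 16 * ((6 + 8 * cos C + 2 * cos D) / 16))
  = 9 + 12 * cos C + 3 * cos D + 12 * cos A + 16 * (cos A * cos C)
    + 4 * (cos A * cos D) + 3 * cos B + 4 * (cos B * cos C) + cos B * cos D.
  by field.
rewrite !prod /A /B /C /D.
rewrite -[cos (2 * (x - phi) - 2 * (2 * x - phi))]cosN.
rewrite -[cos (2 * (x - phi) - 4 * (2 * x - phi))]cosN.
rewrite -[cos (4 * (x - phi) - 4 * (2 * x - phi))]cosN.
have -> : 2 * (2 * x - phi) = 4 * x - 2 * phi by ring.
have -> : 4 * (2 * x - phi) = 8 * x - 4 * phi by ring.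
have -> : 2 * (x - phi) = 2 * x - 2 * phi by ring.
have -> : 4 * (x - phi) = 4 * x - 4 * phi by ring.
have -> : - (2 * x - 2 * phi - (4 * x - 2 * phi)) = 2 * x by ring.
have -> : - (2 * x - 2 * phi - (8 * x - 4 * phi)) = 6 * x - 2 * phi by ring.
have -> : - (4 * x - 4 * phi - (8 * x - 4 * phi)) = 4 * x by ring.
have -> : 2 * x - 2 * phi + (4 * x - 2 * phi) = 6 * x - 4 * phi by ring.
have -> : 2 * x - 2 * phi + (8 * x - 4 * phi) = 10 * x - 6 * phi by ring.
have -> : 4 * x - 4 * phi + (4 * x - 2 * phi) = 8 * x - 6 * phi by ring.
have -> : 4 * x - 4 * phi + (8 * x - 4 * phi) = 12 * x - 8 * phi by ring.
have -> : 4 * x - 4 * phi - (4 * x - 2 * phi) = - (2 * phi) by ring.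
by rewrite cosN; field.
Qed.

(** With x = pi t / N this is 2^(- 4 m) times the fourth power of the
    modulus of the first m factors of the product for the transform, the
    parameter phi being half of the phase attached to the digit sum. *)
Definition cos4prod m phi x := \prod_(j < m) cos (2 ^+ j * x - phi) ^+ 4.

Lemma cos4prodS m phi x :
  cos4prod m.+1 phi x = cos (x - phi) ^+ 4 * cos4prod m phi (2 * x).
Proof.
rewrite /cos4prod big_ord_recl expr0 mul1r; congr (_ * _); apply: eq_bigr => j _.
by rewrite lift0 (exprSr 2 j) -mulrA.
Qed.

Lemma cos4prodSr m phi x :
  cos4prod m.+1 phi x = cos4prod m phi x * cos (2 ^+ m * x - phi) ^+ 4.
Proof. by rewrite /cos4prod big_ord_recr. Qed.

Lemma cos4_ge0 a : 0 <= cos a ^+ 4.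
Proof. by rewrite exprn_even_ge0. Qed.

Lemma cos4_le1 a : cos a ^+ 4 <= 1.
Proof. by rewrite -[_ ^+ 4]ger0_norm ?cos4_ge0// normrX exprn_ile1// cos_max. Qed.

Lemma cos4prod_ge0 m phi x : 0 <= cos4prod m phi x.
Proof. by apply: prodr_ge0 => j _; exact: cos4_ge0. Qed.

Lemma cos4prodSr_le m phi x : cos4prod m.+1 phi x <= cos4prod m phi x.
Proof. by rewrite cos4prodSr ler_piMr ?cos4prod_ge0// cos4_le1. Qed.

Lemma cos4Dpin a k : cos (a + pi *+ k) ^+ 4 = cos a ^+ 4.
Proof. by rewrite cosDpin exprMn sign4 mul1r. Qed.

Lemma sin4Dpin a k : sin (a + pi *+ k) ^+ 4 = sin a ^+ 4.
Proof. by rewrite sinDpin exprMn sign4 mul1r. Qed.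

Lemma cos4prodDpin m phi x k : cos4prod m phi (x + pi *+ k) = cos4prod m phi x.
Proof.
apply: eq_bigr => j _; rewrite mulrDr.
have -> : 2 ^+ j * (pi *+ k) = pi *+ (2 ^ j * k)%N :> R.
  by rewrite mulnC mulrnA -[RHS]mulr_natl natrX.
by rewrite addrAC cos4Dpin.
Qed.

Lemma cos4prodDpi m phi x : cos4prod m phi (x + pi) = cos4prod m phi x.
Proof. exact: (cos4prodDpin m phi x 1). Qed.

End CosPowers.

(** * The mean of the product over all residues *)

Section Sums.
Variables (R : realType) (n : nat).
Hypothesis n_gt1 : (1 < n)%N.
Local Notation N := (mersenne n).
Local Notation angle := (@half_angle R n).
Implicit Types (a phi : R).

Lemma not_dvdz_mersenne (r : int) : (0 < `|r| < N)%N -> ~~ (N %| r)%Z.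
Proof.
move=> /andP[r0 rN]; rewrite dvdzE; apply/negP => h.
by move: rN; rewrite ltnNge dvdn_leq.
Qed.

(** Expanding the cosine powers gives only frequencies r + u k with
    |k| <= 2 (2^m - 1), and a frequency that N does not divide has zero sum.
    The first factor shifts r by 0, u, - u, 2 u or - 2 u and doubles u, hence
    the induction. *)
Lemma sum_cos_mul_cos4prod m phi (r u : int) a :
  (forall k : int, (`|k| <= 2 * (2 ^ m - 1))%N -> ~~ (N %| r + u * k)%Z) ->
  \sum_(t : residue n)
     cos (2 * r%:~R * angle t + a) * cos4prod m phi (u%:~R * angle t) = 0.
Proof.
elim: m r u a => [|m IH] r u a Nruk.
  under eq_bigr do rewrite /cos4prod big_ord0 mulr1.
  by apply: sum_cos_residue => //; have := Nruk 0 isT; rewrite mulr0 addr0.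
set P := fun (s : int) (t : residue n) (b : R) =>
  cos (2 * (r + s * u)%:~R * angle t + b) * cos4prod m phi ((2 * u)%:~R * angle t).
have P0 (s : int) b : (`|s| <= 2)%N -> \sum_(t : residue n) P s t b = 0.
  move=> s2; apply: IH => k km.
  have -> : r + s * u + 2 * u * k = r + u * (s + 2 * k) by ring.
  apply: Nruk; have := expn_gt0 2 m; rewrite expnS; lia.
have E (t : residue n) :
  cos (2 * r%:~R * angle t + a) * cos4prod m.+1 phi (u%:~R * angle t) =
  6 / 16 * P 0 t a + 4 / 16 * P 1 t (a - 2 * phi) + 4 / 16 * P (-1) t (a + 2 * phi)
  + 1 / 16 * P 2 t (a - 4 * phi) + 1 / 16 * P (-2) t (a + 4 * phi).
  rewrite cos4prodS mulrA cos_mul_cos4 /P.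
  have -> : 2 * (u%:~R * angle t) = (2 * u)%:~R * angle t by rewrite rmorphM/= mulrA.
  set x := angle t; set H := cos4prod _ _ _.
  rewrite !rmorphD !rmorphM /= !rmorphN /=.
  have -> : 2 * (r%:~R + 0 * u%:~R) * x + a = 2 * r%:~R * x + a by ring.
  have -> : 2 * (r%:~R + 1 * u%:~R) * x + (a - 2 * phi) =
            2 * r%:~R * x + a + 2 * (u%:~R * x - phi) by ring.
  have -> : 2 * (r%:~R + -1 * u%:~R) * x + (a + 2 * phi) =
            2 * r%:~R * x + a - 2 * (u%:~R * x - phi) by ring.
  have -> : 2 * (r%:~R + 2 * u%:~R) * x + (a - 4 * phi) =
            2 * r%:~R * x + a + 4 * (u%:~R * x - phi) by ring.
  have -> : 2 * (r%:~R + -2 * u%:~R) * x + (a + 4 * phi) =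
            2 * r%:~R * x + a - 4 * (u%:~R * x - phi) by ring.
  by field.
under eq_bigr do rewrite E.
by rewrite !big_split /= -!mulr_sumr !P0// !mulr0 !addr0.
Qed.

Definition fourth_sum m phi := \sum_(t : residue n) cos4prod m phi (angle t).

Lemma fourth_sum_ge0 m phi : 0 <= fourth_sum m phi.
Proof. by apply: sumr_ge0 => t _; exact: cos4prod_ge0. Qed.

Lemma fourth_sumS_le m phi : fourth_sum m.+1 phi <= fourth_sum m phi.
Proof. by apply: ler_sum => t _; exact: cos4prodSr_le. Qed.

Lemma sum_cos4prod_double m phi :
  \sum_(t : residue n) cos4prod m phi (2 * angle t) = fourth_sum m phi.
Proof. by apply: (sum_double n_gt1) => x; exact: cos4prodDpi. Qed.

Lemma sum_cos4prod_quadruple m phi :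
  \sum_(t : residue n) cos4prod m phi (4 * angle t) = fourth_sum m phi.
Proof.
rewrite -sum_cos4prod_double.
rewrite -[RHS](sum_double n_gt1 (F := fun x => cos4prod m phi (2 * x))) => [|x].
  by apply: eq_bigr => t _; congr cos4prod; ring.
have -> : 2 * (x + pi) = 2 * x + pi *+ 2 by rewrite mulrDr [2 * pi]mulr_natl.
exact: cos4prodDpin.
Qed.

(** One factor alone gives no gain over 1/2, uniformly in phi. Two
    consecutive factors do: after the frequencies in x that are not multiples
    of 8 have been discarded, their product is at most
    (14 + 2 cos (2 phi)) / 64 = (1 - (sin phi)^2 / 4) / 4 pointwise, and the
    remaining factors are nonnegative. The condition m + 3 <= n keeps all
    frequencies below N. *)
Lemma fourth_sum_two_steps m phi : (m + 3 <= n)%N ->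
  fourth_sum m.+2 phi <= (1 - sin phi ^+ 2 / 4) / 4 * fourth_sum m phi.
Proof.
move=> mn.
(* The variable of the remaining product is 4 x: a frequency r that is not a
   multiple of 4 cannot be cancelled by it. *)
have killed (r : nat) a : (r < 7)%N -> (r %% 4 != 0)%N ->
    \sum_(t : residue n) cos (2 * r%:R * angle t + a) * cos4prod m phi (4 * angle t) = 0.
  move=> r7 r4; rewrite -[4]/(4%:~R) -[r%:R]/(r%:~R).
  apply: sum_cos_mul_cos4prod => k km; apply: not_dvdz_mersenne.
  have := leq_pexp2l (isT : 0 < 2)%N mn; rewrite expnD /mersenne.
  by have := expn_gt0 2 m; lia.
(* The discarded terms of cos4_mul_cos4 as triples: coefficient, frequency,
   phase. *)
set l : seq (R * nat * R) := [:: (12, 1%N, - (2 * phi)); (8, 1%N, 0);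
  (12, 2%N, - (2 * phi)); (3, 2%N, - (4 * phi)); (2^-1, 2%N, 0);
  (8, 3%N, - (4 * phi)); (2, 3%N, - (2 * phi)); (2, 5%N, - (6 * phi));
  (2^-1, 6%N, - (8 * phi))].
set K := fun x => \sum_(p <- l) p.1.1 * cos (2 * p.1.2%:R * x + p.2).
have K0 : \sum_(t : residue n) K (angle t) * cos4prod m phi (4 * angle t) = 0.
  under eq_bigr do rewrite /K mulr_suml.
  rewrite exchange_big /=.
  under eq_bigr do under eq_bigr do rewrite -mulrA.
  under eq_bigr do rewrite -mulr_sumr.
  by rewrite !big_cons big_nil /= !killed// !mulr0 !addr0.
have -> : (1 - sin phi ^+ 2 / 4) / 4 * fourth_sum m phi =
    \sum_(t : residue n) ((1 - sin phi ^+ 2 / 4) / 4 * cos4prod m phi (4 * angle t)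
      + 64^-1 * (K (angle t) * cos4prod m phi (4 * angle t))).
  by rewrite big_split /= -!mulr_sumr K0 mulr0 addr0 sum_cos4prod_quadruple.
apply: ler_sum => t _; set x := angle t.
rewrite !cos4prodS mulrA; have -> : 2 * (2 * x) = 4 * x by ring.
rewrite [64^-1 * _]mulrA -mulrDl ler_wpM2r ?cos4prod_ge0//.
rewrite -(ler_pM2l (_ : 0 < 64))// cos4_mul_cos4.
have -> : K x = 12 * cos (2 * x - 2 * phi) + 8 * cos (2 * x) + 12 * cos (4 * x - 2 * phi)
     + 3 * cos (4 * x - 4 * phi) + cos (4 * x) / 2 + 8 * cos (6 * x - 4 * phi)
     + 2 * cos (6 * x - 2 * phi) + 2 * cos (10 * x - 6 * phi)
     + cos (12 * x - 8 * phi) / 2.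
  rewrite /K !big_cons big_nil /= !addr0.
  have -> : 2 * 1%:R * x = 2 * x by ring.
  have -> : 2 * 2%:R * x = 4 * x by ring.
  have -> : 2 * 3%:R * x = 6 * x by ring.
  have -> : 2 * 5%:R * x = 10 * x by ring.
  have -> : 2 * 6%:R * x = 12 * x by ring.
  by field.
have c2 : cos (2 * phi) = 1 - 2 * sin phi ^+ 2.
  by rewrite mulr_natl cos_mulr2n cos2sin2; ring.
rewrite c2.
have := cos_le1 (8 * x - 4 * phi); have := cos_le1 (8 * x - 6 * phi).
lra.
Qed.

End Sums.

(** * The sum over nonzero residues *)

Section Decay.
Variables (R : realType) (n : nat).
Hypothesis n_gt1 : (1 < n)%N.
Local Notation N := (mersenne n).
Local Notation angle := (@half_angle R n).
Implicit Types a b x phi : R.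

(** The bound 1 - (sin phi)^2 / 4 for a pair of factors is at most the square
    of this number, so each digit contributes decay phi / 2. *)
Definition decay phi := 1 - sin phi ^+ 2 / 8.

Lemma decay_bounds phi : 7 / 8 <= decay phi <= 1.
Proof.
have := sqr_ge0 (sin phi); have := sqr_ge0 (cos phi); rewrite cos2sin2 /decay.
by move=> *; apply/andP; split; lra.
Qed.

Lemma fourth_sum_le_below m phi : (m < n)%N ->
  fourth_sum n m phi <= 4 * 2 ^+ n * (decay phi / 2) ^+ m.
Proof.
have /andP[t1 t2] := decay_bounds phi.
have f0 : fourth_sum n 0 phi <= 2 ^+ n.
  rewrite /fourth_sum; under eq_bigr do rewrite /cos4prod big_ord0.
  rewrite (sum_residue n_gt1 (fun=> 1)) sumr_const card_ord.
  by rewrite -(mersenne_natr R n) lerDl.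
have p2 : 0 < 2 ^+ n :> R by rewrite exprn_gt0.
suff: ((m < n)%N -> fourth_sum n m phi <= 4 * 2 ^+ n * (decay phi / 2) ^+ m) /\
  ((m.+1 < n)%N -> fourth_sum n m.+1 phi <= 4 * 2 ^+ n * (decay phi / 2) ^+ m.+1).
  by case.
elim: m => [|m [IH0 IH1]]; split.
- by move=> _; rewrite expr0 mulr1; lra.
- move=> _; rewrite (le_trans (fourth_sumS_le _ _ _))// (le_trans f0)// expr1.
  by rewrite -mulrA mulrCA ler_peMr; lra.
- exact: IH1.
- move=> mn; have mn3 : (m + 3 <= n)%N by rewrite addn3.
  apply: (le_trans (fourth_sum_two_steps n_gt1 phi mn3)).
  apply: (@le_trans _ _ ((decay phi / 2) ^+ 2 * fourth_sum n m phi)).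
    rewrite ler_wpM2r ?fourth_sum_ge0//.
    have := sqr_ge0 (sin phi ^+ 2); rewrite /decay; lra.
  rewrite -(addn2 m) exprD mulrA [leRHS]mulrC ler_wpM2l ?sqr_ge0//.
  by apply: IH0; lia.
Qed.

(** fourth_sum_two_steps does not reach the last factor, which is bounded
    by 1 at the cost of a constant. *)
Lemma fourth_sum_le m phi : (m <= n)%N ->
  fourth_sum n m phi <= 16 * 2 ^+ n * (decay phi / 2) ^+ m.
Proof.
have /andP[t1 t2] := decay_bounds phi.
have p2 : 0 < 2 ^+ n :> R by rewrite exprn_gt0.
have q0 k : 0 <= 2 ^+ n * (decay phi / 2) ^+ k.
  by rewrite mulr_ge0 ?exprn_ge0//; lra.
rewrite leq_eqVlt => /orP[/eqP mE|mn].
  have [k nE] : {k | n = k.+1} by exists n.-1; rewrite prednK// ltnW.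
  rewrite mE {2}nE (le_trans (fourth_sumS_le _ _ _))//.
  apply: (le_trans (fourth_sum_le_below _ _)); first by rewrite nE.
  have -> : (decay phi / 2) ^+ n = decay phi / 2 * (decay phi / 2) ^+ k.
    by rewrite nE exprS.
  have := q0 k; rewrite -!mulrA; set Q := 2 ^+ n * _.
  have -> : 2 ^+ n * (decay phi * (2^-1 * (decay phi / 2) ^+ k)) = decay phi * Q / 2.
    by rewrite /Q; field.
  nra.
apply: (le_trans (fourth_sum_le_below _ mn)).
by have := q0 m; lra.
Qed.

(** From 2 sin y cos y = sin (2 y), with y = x - phi, and
    sin (2 x - 2 phi) = sin ((2 x - phi) - phi), the modulus of
    sin (x - phi) cos (x - phi) is at most
    (|sin (2 x - phi)| + |sin phi|) / 2. The fourth power of the sum is split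
    unevenly, so that the first coefficient 4 / 27 stays below 7 / 16, the
    least possible value of decay phi / 2. *)
Lemma sin4_cos4_le x phi :
  sin (x - phi) ^+ 4 * cos (x - phi) ^+ 4 <=
  4 / 27 * sin (2 * x - phi) ^+ 4 + 4 * sin phi ^+ 4.
Proof.
have e : 2 * (sin (x - phi) * cos (x - phi)) = sin ((2 * x - phi) + - phi).
  rewrite [_ * cos _]mulrC mulr_natl -sin_mulr2n; congr sin; ring.
have := sin_abs_add (2 * x - phi) (- phi); rewrite -e sinN normrN.
set p := sin (x - phi) * cos (x - phi); rewrite -exprMn -/p.
set u := sin (2 * x - phi); set v := sin phi.
have n4 (y : R) : y ^+ 4 = `|y| ^+ 4 by rewrite -normrX ger0_norm// exprn_even_ge0.
rewrite (n4 p) (n4 u) (n4 v) normrM ger0_norm//.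
move: `|p| `|u| `|v| (normr_ge0 p) (normr_ge0 u) (normr_ge0 v) => P U V P0 U0 V0 h.
have h4 : P ^+ 4 <= ((U + V) / 2) ^+ 4 by apply: lerXn2r; rewrite ?nnegrE; lra.
apply: (le_trans h4).
have -> : ((U + V) / 2) ^+ 4 = (U + V) ^+ 4 / 16 by field.
rewrite -subr_ge0.
have -> : 4 / 27 * U ^+ 4 + 4 * V ^+ 4 - (U + V) ^+ 4 / 16 =
  (U - 3 * V) ^+ 2 * (37 * U ^+ 2 + 114 * U * V + 189 * V ^+ 2) / 432.
  by field.
rewrite divr_ge0// mulr_ge0 ?sqr_ge0//; nra.
Qed.

(** For small phi the product is concentrated near x = phi, where the extra
    factor is small, so that this sum is smaller than fourth_sum by a factor of order (sin phi)^4, up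
    to an exponentially small term. *)
Definition sine_sum m phi := \sum_(t : residue n)
  sin (angle t - phi) ^+ 4 * cos4prod m phi (angle t).

Lemma sine_sumS m phi :
  sine_sum m.+1 phi <= 4 / 27 * sine_sum m phi + 4 * sin phi ^+ 4 * fourth_sum n m phi.
Proof.
pose F x := sin (x - phi) ^+ 4 * cos4prod m phi x.
have FE : sine_sum m phi = \sum_(t : residue n) F (2 * angle t).
  rewrite (sum_double n_gt1 (F := F))// => x.
  by rewrite /F cos4prodDpi addrAC (sin4Dpin _ 1).
rewrite FE -sum_cos4prod_double// !mulr_sumr -big_split /=.
apply: ler_sum => t _; rewrite cos4prodS mulrA /F [4 / 27 * _]mulrA -mulrDl.
by rewrite ler_wpM2r ?cos4prod_ge0// sin4_cos4_le.
Qed.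

(** The recursion of sine_sumS contracts faster (4 / 27) than the terms
    fed into it decay (decay phi / 2 >= 7 / 16). *)
Lemma sine_sum_le m phi : (m <= n)%N ->
  sine_sum m phi <=
  2 ^+ n * (4 / 27) ^+ m + 256 * sin phi ^+ 4 * (2 ^+ n * (decay phi / 2) ^+ m).
Proof.
have /andP[t1 t2] := decay_bounds phi.
have s0 : 0 <= sin phi ^+ 4 by rewrite exprn_even_ge0.
have p2 : 0 < 2 ^+ n :> R by rewrite exprn_gt0.
elim: m => [|m IH] mn.
  rewrite !expr0 !mulr1 -[leLHS]addr0 lerD//; last by apply: mulr_ge0; [lra|exact: ltW].
  rewrite -(mersenne_natr R n) (@le_trans _ _ (mersenne n)%:R) ?lerDl//.
  have -> : (mersenne n)%:R = \sum_(t : residue n) 1 :> R.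
    by rewrite (sum_residue n_gt1 (fun=> 1)) sumr_const card_ord.
  apply: ler_sum => t _; rewrite /cos4prod big_ord0 mulr1.
  by rewrite -[leLHS]ger0_norm ?exprn_even_ge0// normrX exprn_ile1// sin_max.
apply: (le_trans (sine_sumS _ _)).
have f16 := ler_wpM2l s0 (fourth_sum_le phi (ltnW mn)).
have b256 := IH (ltnW mn).
set Z := sin phi ^+ 4 * (2 ^+ n * (decay phi / 2) ^+ m).
have Z0 : 0 <= Z by apply: mulr_ge0 => //; apply: mulr_ge0; [exact: ltW|apply: exprn_ge0; lra].
have fZ : sin phi ^+ 4 * fourth_sum n m phi <= 16 * Z.
  by apply: (le_trans f16); rewrite /Z le_eqVlt; apply/orP; left; apply/eqP; ring.
have -> : 256 * sin phi ^+ 4 * (2 ^+ n * (decay phi / 2) ^+ m.+1) =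
    128 * (decay phi * Z) by rewrite /Z (exprS (decay phi / 2)); field.
have bZ : sine_sum m phi <= 2 ^+ n * (4 / 27) ^+ m + 256 * Z.
  by rewrite /Z (mulrA 256).
have -> : 2 ^+ n * (4 / 27) ^+ m.+1 = 4 / 27 * (2 ^+ n * (4 / 27) ^+ m) :> R.
  by rewrite (exprS (4 / 27)) mulrCA.
have dZ : 7 / 8 * Z <= decay phi * Z by rewrite ler_wpM2r.
rewrite -mulrA; lra.
Qed.

Lemma cos4prod_rotate phi (t : residue n) :
  cos4prod n phi (2 * angle t) = cos4prod n phi (angle t).
Proof.
have [k nE] : {k | n = k.+1} by exists n.-1; rewrite prednK// ltnW.
have first_factor x : cos4prod n phi x = cos (x - phi) ^+ 4 * cos4prod k phi (2 * x).
  by rewrite [in LHS]nE cos4prodS.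
have last_factor x : cos4prod n phi x = cos4prod k phi x * cos (2 ^+ k * x - phi) ^+ 4.
  by rewrite [in LHS]nE cos4prodSr.
rewrite last_factor first_factor mulrC; congr (_ * _).
rewrite (mulrA _ 2) -(exprSr 2 k) -nE.
have -> : 2 ^+ n * angle t - phi = angle t - phi + pi *+ t.
  rewrite -(mersenne_natr R n) mulrDl mul1r mulrC half_angleE// mulr_natr; ring.
exact: cos4Dpin.
Qed.

(** While (sin y)^2 < 1/2, doubling y at least doubles (sin y)^2. This cannot
    go on for n steps, since n doublings bring pi t / N back to itself modulo
    pi. *)
Lemma exists_large_sin (t : residue n) : t != 0 ->
  exists j : 'I_n, 2^-1 <= sin (2 ^+ j * angle t) ^+ 2.
Proof.
move=> t0; have N0 := mersenne_pos R n_gt1.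
apply/existsP; apply: contraT => small.
have {}small (j : nat) : (j < n)%N -> sin (2 ^+ j * angle t) ^+ 2 < 2^-1.
  by move=> jn; rewrite ltNge; apply: contra small => h; apply/existsP; exists (Ordinal jn).
have grow (j : nat) : (j <= n)%N ->
    2 ^+ j * sin (angle t) ^+ 2 <= sin (2 ^+ j * angle t) ^+ 2.
  elim: j => [|j IH] jn; first by rewrite expr0 !mul1r.
  have := IH (ltnW jn); have := small _ jn.
  have -> : 2 ^+ j.+1 * angle t = (2 ^+ j * angle t) *+ 2.
    by rewrite exprS -mulrA mulr_natl.
  rewrite sin_mulr2n (exprS 2 j); move: (2 ^+ j * angle t) => y.
  rewrite -(mulr_natl (cos y * _)) !exprMn cos2sin2 -(mulrA 2).
  move: (2 ^+ j * _) (sin y ^+ 2) (sqr_ge0 (sin y)) => a b b0 b1 ab; nra.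
have := grow n (leqnn n).
have -> : 2 ^+ n * angle t = angle t + pi *+ t.
  by rewrite -(mersenne_natr R n) mulrDl mul1r mulrC half_angleE// mulr_natr addrC.
rewrite sinDpin exprMn -exprM mulnC exprM -signr_odd /= expr1n mul1r.
have : 0 < sin (angle t).
  apply: sin_gt0_pi; rewrite /half_angle; apply/andP; split.
    by rewrite divr_gt0// mulr_gt0 ?pi_gt0// ltr0n lt0n.
  by rewrite ltr_pdivrMr// ltr_pM2l ?pi_gt0// ltr_nat residue_lt.
have : 2 <= 2 ^+ n :> R by rewrite ler_eXnr//; lia || lra.
by move=> *; nra.
Qed.

(** By exists_large_sin the sum over j < n of sin (2^j x)^4 is at least 1/4
    for every nonzero residue, and the product is invariant under doubling.
    So the sum is at most 4 n times the sum of sin(x)^4 times the product,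
    and sin(x)^4 is compared with sin(x - phi)^4 and sin(phi)^4. This is where
    the term t = 0, which is of order 1, is separated from the others. *)
Lemma sum_cos4prod_le phi :
  \sum_(t : residue n | t != 0) cos4prod n phi (angle t) <=
  32 * n%:R * ((8 / 27) ^+ n + 272 * sin phi ^+ 4 * decay phi ^+ n).
Proof.
pose A (j : nat) := \sum_(t : residue n)
  sin (2 ^+ j * angle t) ^+ 4 * cos4prod n phi (angle t).
(* Replacing x by 2 x shifts the exponent j. *)
have AS j : A j = A 0.
  elim: j => // j <-; rewrite /A.
  rewrite -(sum_double n_gt1
     (F := fun x => sin (2 ^+ j * x) ^+ 4 * cos4prod n phi x)) => [|x].
    by apply: eq_bigr => t _; rewrite cos4prod_rotate mulrA -exprSr.
  rewrite cos4prodDpi mulrDr.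
  have -> : 2 ^+ j * pi = pi *+ (2 ^ j) :> R by rewrite -[RHS]mulr_natl natrX.
  by rewrite sin4Dpin.
have step1 : \sum_(t : residue n | t != 0) cos4prod n phi (angle t) <=
    4 * \sum_(j < n) A j.
  rewrite /A exchange_big mulr_sumr /= [leRHS](bigID (fun t => t != 0)) /=.
  rewrite -[leLHS]addr0 lerD//; last first.
    apply: sumr_ge0 => t _; apply: mulr_ge0 => //; apply: sumr_ge0 => j _.
    by apply: mulr_ge0; rewrite ?cos4prod_ge0// exprn_even_ge0.
  apply: ler_sum => t t0; have [j sj] := exists_large_sin t0.
  rewrite -mulr_suml mulrA ler_peMl ?cos4prod_ge0//.
  rewrite (bigD1 j)//= mulrDr -[leLHS]addr0 lerD//.
    by rewrite (_ : 4%N = (2 * 2)%N)// exprM; nra.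
  by apply: mulr_ge0 => //; apply: sumr_ge0 => i _; rewrite exprn_even_ge0.
apply: (le_trans step1).
under eq_bigr do rewrite AS.
rewrite sumr_const card_ord -(mulr_natl (A 0)).
have step2 : A 0 <= 8 * (sine_sum n phi + sin phi ^+ 4 * fourth_sum n n phi).
  rewrite /A /sine_sum /fourth_sum mulrDr mulrA !mulr_sumr -big_split /=.
  apply: ler_sum => t _; rewrite mulrA -mulrDl ler_wpM2r ?cos4prod_ge0//.
  rewrite expr0 mul1r.
  have := sin_abs_add (angle t - phi) phi; rewrite subrK.
  have n4 (y : R) : y ^+ 4 = `|y| ^+ 4.
    by rewrite -normrX ger0_norm// exprn_even_ge0.
  rewrite (n4 (sin (angle t))) (n4 (sin (_ - _))) (n4 (sin phi)).
  move: `|sin (angle t)| `|sin (angle t - phi)| `|sin phi|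
    (normr_ge0 (sin (angle t))) (normr_ge0 (sin (angle t - phi))) (normr_ge0 (sin phi)).
  move=> P U V P0 U0 V0 h.
  have h4 : P ^+ 4 <= (U + V) ^+ 4 by apply: lerXn2r; rewrite ?nnegrE; lra.
  apply: (le_trans h4); rewrite -subr_ge0.
  have -> : 8 * U ^+ 4 + 8 * V ^+ 4 - (U + V) ^+ 4 =
    (U - V) ^+ 2 * (7 * U ^+ 2 + 10 * U * V + 7 * V ^+ 2) by ring.
  rewrite mulr_ge0 ?sqr_ge0//; nra.
have s0 : 0 <= sin phi ^+ 4 by rewrite exprn_even_ge0.
have two_half (q : R) : 2 ^+ n * (q / 2) ^+ n = q ^+ n.
  by rewrite -exprMn mulrCA divff ?mulr1 ?pnatr_eq0.
have := ler_wpM2l s0 (fourth_sum_le phi (leqnn n)).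
have := sine_sum_le phi (leqnn n).
rewrite -(mulrA 16) two_half -exprMn.
have -> : 2 * (4 / 27) = 8 / 27 :> R by field.
rewrite (mulrCA _ 16) -!(mulrA _ (sin phi ^+ 4)).
move=> b f; have A8 : A 0 <= 8 * ((8 / 27) ^+ n + 272 * (sin phi ^+ 4 * decay phi ^+ n)).
  by apply: (le_trans step2); lra.
have -> : 32 * n%:R = 4 * (n%:R * 8) :> R by ring.
rewrite -2!mulrA; apply: ler_wpM2l => //; apply: ler_wpM2l => //.
Qed.

End Decay.

(** * Residues as sets of binary digits *)

Section Binary.
Variable n : nat.

Definition set_val (A : {set 'I_n}) : nat := (\sum_(i in A) 2 ^ i)%N.

Definition bits (x : nat) : {set 'I_n} := [set i : 'I_n | odd (x %/ 2 ^ i)].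

Lemma sum_bits m x : (x < 2 ^ m)%N -> (\sum_(i < m) odd (x %/ 2 ^ i) * 2 ^ i)%N = x.
Proof.
elim: m x => [|m IH] x; first by rewrite big_ord0; case: x.
rewrite expnS mul2n => xm; rewrite big_ord_recl expn0 divn1 muln1.
under eq_bigr => i _ do rewrite lift0 expnS divnMA mulnCA.
rewrite -big_distrr /= IH; first by rewrite divn2 mul2n odd_double_half.
by rewrite divn2 ltn_half_double.
Qed.

Lemma bitsK x : (x < 2 ^ n)%N -> set_val (bits x) = x.
Proof.
move=> xn; rewrite -[RHS](sum_bits xn) /set_val big_mkcond.
by apply: eq_bigr => i _; rewrite inE; case: odd; rewrite ?mul1n.
Qed.

(** bits is injective on [0, 2^n), which has as many elements as the power set
    of 'I_n. *)
Lemma bits_surj (A : {set 'I_n}) : exists2 x, (x < 2 ^ n)%N & A = bits x.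
Proof.
have inj : injective (fun x : 'I_(2 ^ n) => bits x).
  by move=> x y /(congr1 set_val); rewrite !bitsK// => /val_inj.
have [|g _ gK] := inj_card_bij inj; first by rewrite card_ord -cardsT -powersetT card_powerset cardsT card_ord.
by exists (g A); rewrite ?gK.
Qed.

Lemma set_valK : cancel set_val bits.
Proof. by move=> A; have [x xn ->] := bits_surj A; rewrite bitsK. Qed.

Lemma set_val_lt (A : {set 'I_n}) : (set_val A < 2 ^ n)%N.
Proof. by have [x xn ->] := bits_surj A; rewrite bitsK. Qed.

Lemma set_val_setT : (set_val [set: 'I_n]).+1 = (2 ^ n)%N.
Proof.
have -> : set_val [set: 'I_n] = (2 ^ n).-1.
  by rewrite predn_exp mul1n; apply: eq_bigl => i; rewrite in_setT.
by rewrite prednK// expn_gt0.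
Qed.

End Binary.

Section WeightClass.
Variable n : nat.
Hypothesis n_gt1 : (1 < n)%N.
Local Notation N := (mersenne n).

Lemma set_val_lt_mersenne (A : {set 'I_n}) : (#|A| < n)%N -> (set_val A < N)%N.
Proof.
move=> An; have := set_val_lt A; rewrite -(mersenneS n) ltnS leq_eqVlt.
case/orP => // /eqP e; move: An.
have /(can_inj (@set_valK n)) -> : set_val A = set_val [set: 'I_n].
  by apply/eqP; rewrite e -eqSS mersenneS set_val_setT.
by rewrite cardsT card_ord ltnn.
Qed.

(** Residues with digit sum w < n correspond to sets of w positions; the
    full set is excluded because its value 2^n - 1 is not a representative. *)
Lemma sum_weight_class (V : nmodType) (F : nat -> V) w : (w < n)%N ->
  \sum_(x in weight_class n w) F x = \sum_(A : {set 'I_n} | #|A| == w) F (set_val A).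
Proof.
move=> wn; rewrite [RHS](reindex_onto (fun x : residue n => bits n x)
  (fun A => inZp (set_val A))) /= => [|A /eqP Aw].
  apply: eq_big => [x|x _].
    rewrite !inE /wt bitsK.
      have -> : inZp x == x by apply/eqP/val_inj; rewrite /= modn_small.
      by rewrite andbT.
    by rewrite -(mersenneS n) ltnW// ltnS residue_lt.
  by rewrite bitsK// -(mersenneS n) ltnW// ltnS residue_lt.
rewrite -[RHS]set_valK; congr bits; rewrite /= Zp_cast ?mersenne_gt1//.
by rewrite modn_small// set_val_lt_mersenne// Aw.
Qed.

End WeightClass.

(** * The transform of a weight class as a sum of products *)

Section FourierFormula.
Variables (R : realType) (n : nat).
Hypothesis n_gt1 : (1 < n)%N.
Local Notation N := (mersenne n).
Local Notation angle := (@half_angle R n).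

Lemma expi_sum (I : Type) (r : seq I) (P : pred I) (F : I -> R) :
  expi (\sum_(i <- r | P i) F i) = \prod_(i <- r | P i) expi (F i).
Proof. exact: (big_morph _ (@expiD R) (expi0 R)). Qed.

Definition wave (j t : nat) : R[i] := expi (- (2 * pi * 2 ^+ j * t%:R / N%:R)).

Lemma expi_set_val (A : {set 'I_n}) (t : nat) :
  expi (- (2 * pi * (set_val A)%:R * t%:R / N%:R)) = \prod_(j in A) wave j t.
Proof.
rewrite -expi_sum; congr expi.
rewrite /set_val natr_sum mulr_sumr !mulr_suml -sumrN.
by apply: eq_bigr => j _; rewrite natrX.
Qed.

Lemma prod_wave_expand (z : R[i]) t : \prod_(j < n) (1 + z * wave j t) =
  \sum_(A : {set 'I_n}) z ^+ #|A| * \prod_(j in A) wave j t.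
Proof.
under eq_bigr do rewrite addrC.
rewrite bigA_distr; apply: eq_bigr => A _.
rewrite (bigID (mem A)) /= mulrC big1 ?mul1r => [|j /negPf->//].
under eq_bigr => j jA do rewrite jA.
by rewrite big_split /= prodr_const.
Qed.

(** Digit sums are at most n, so (n + 1)-st roots of unity separate them. *)
Lemma weight_filter (A : {set 'I_n}) w : (w <= n)%N ->
  \sum_(k < n.+1) expi (- (2 * pi * k%:R * w%:R / n.+1%:R)) *
     expi (2 * pi * k%:R / n.+1%:R) ^+ #|A| = (if #|A| == w then n.+1%:R else 0) :> R[i].
Proof.
move=> wn; have := sum_expi R (#|A|%:Z - w%:Z) (ltn0Sn n).
have -> : (n.+1 %| #|A|%:Z - w%:Z)%Z = (#|A| == w).
  apply/idP/eqP => [|->]; last by rewrite subrr dvdz0.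
  rewrite dvdzE /=; have := max_card A; rewrite card_ord => An.
  move: An; move: #|A| => a an; case: (posnP `|a%:Z - w%:Z|%N) => [e0 _|p /(dvdn_leq p)]; last lia.
  by apply/eqP; rewrite -eqz_nat -subr_eq0 -absz_eq0 e0.
move=> <-; apply: eq_bigr => k _; rewrite -expiMn -expiD; congr expi.
have : n.+1%:R != 0 :> R by rewrite pnatr_eq0.
rewrite -(mulr_natr (_ / _)) rmorphB /= -!pmulrn; move: n.+1%:R => M M0; by field.
Qed.

(** Detecting the digit sum by roots of unity leaves a sum over all sets of
    digits, which factors over the digits. *)
Lemma fourier_weight_class (t : residue n) (T : nat) w :
  nat_of_ord t = T -> (w < n)%N ->
  fourier R (weight_class n w) t = N%:R^-1 * (n.+1%:R^-1 *
    \sum_(k < n.+1) expi (- (2 * pi * k%:R * w%:R / n.+1%:R)) *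
       \prod_(j < n) (1 + expi (2 * pi * k%:R / n.+1%:R) * wave j T)).
Proof.
move=> tT wn; rewrite /fourier tT; congr (_ * _).
rewrite (sum_weight_class n_gt1
  (fun x => expi (- (2 * pi * x%:R * T%:R / N%:R)) : R[i]) wn).
under eq_bigr do rewrite expi_set_val.
under [in RHS]eq_bigr do rewrite prod_wave_expand mulr_sumr.
rewrite exchange_big mulr_sumr big_mkcond /=.
apply: eq_bigr => A _.
under [in RHS]eq_bigr do rewrite mulrA.
rewrite -mulr_suml weight_filter 1?ltnW//.
by case: eqP => _; rewrite ?mul0r ?mulr0// mulKf// pnatr_eq0.
Qed.

Lemma normc_1Dexpi (a : R) : Normc.normc (1 + expi (2 * a)) = 2 * `|cos a|.
Proof.
have -> : 1 + expi (2 * a) = (2 * cos a)%:C * expi a.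
  apply/eqP; rewrite eq_complex /= mulr_natl cos_mulr2n sin_mulr2n !mul0r.
  by rewrite subr0 addr0; apply/andP; split; apply/eqP; ring.
rewrite Normc.normcM normc_expi mulr1 /= expr0n addr0 sqrtr_sqr normrM.
by rewrite ger0_norm.
Qed.

Lemma normc_prod (I : Type) (r : seq I) (P : pred I) (F : I -> R[i]) :
  Normc.normc (\prod_(i <- r | P i) F i) = \prod_(i <- r | P i) Normc.normc (F i).
Proof. exact: (big_morph _ (@Normc.normcM R) (Normc.normc1 R)). Qed.

Lemma normc_sum_le (I : Type) (r : seq I) (P : pred I) (F : I -> R[i]) :
  Normc.normc (\sum_(i <- r | P i) F i) <= \sum_(i <- r | P i) Normc.normc (F i).
Proof.
elim/big_ind2: _ => [|x a y b xa yb|//]; first by rewrite Normc.normc0.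
exact: (le_trans (le_normcD _ _) (lerD xa yb)).
Qed.

Lemma normc_nonneg (z : R[i]) : 0 <= Normc.normc z.
Proof. by case: z => x y; rewrite sqrtr_ge0. Qed.

Lemma normc_natV k : Normc.normc (k%:R^-1 : R[i]) = k%:R^-1.
Proof.
rewrite Normc.normcV; congr (_^-1).
by rewrite -(rmorph_nat (real_complex R)) /= expr0n addr0 sqrtr_sqr ger0_norm.
Qed.

Definition half_phase (k : nat) : R := pi * k%:R / n.+1%:R.

Lemma normc_prod_wave k t :
  Normc.normc (\prod_(j < n) (1 + expi (2 * pi * k%:R / n.+1%:R) * wave j t)) ^+ 4 =
  (2 ^+ n) ^+ 4 * cos4prod n (half_phase k) (angle t).
Proof.
have m0 : n.+1%:R != 0 :> R by rewrite pnatr_eq0.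
have N0 : N%:R != 0 :> R by rewrite gt_eqF// mersenne_pos.
have factor (j : nat) : Normc.normc (1 + expi (2 * pi * k%:R / n.+1%:R) * wave j t) ^+ 4 =
    2 ^+ 4 * cos (2 ^+ j * angle t - half_phase k) ^+ 4.
  rewrite -expiD.
  have -> : 2 * pi * k%:R / n.+1%:R - 2 * pi * 2 ^+ j * t%:R / N%:R =
     2 * - (2 ^+ j * angle t - half_phase k).
    rewrite /half_phase /half_angle; move: N%:R n.+1%:R N0 m0 => N' M N0 M0; field.
    by rewrite N0 M0.
  by rewrite normc_1Dexpi cosN exprMn -normrX ger0_norm ?exprn_even_ge0.
rewrite normc_prod -prodrXl; under eq_bigr do rewrite factor.
by rewrite big_split /= prodr_const card_ord -!exprM mulnC.
Qed.

Lemma val_pow2 k : (k < n)%N -> nat_of_ord (2 ^+ k : residue n) = (2 ^ k)%N.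
Proof.
move=> kn; rewrite -natrX val_Zp_nat ?mersenne_gt1// modn_small//.
have h1 : (2 * 2 ^ k <= 2 ^ n)%N by rewrite -expnS leq_exp2l.
have h2 : (2 ^ 2 <= 2 ^ n)%N by rewrite leq_exp2l.
by rewrite /mersenne; have := expn_gt0 2 k; lia.
Qed.

(** Multiplying t by 2 permutes the factors of the product cyclically. Hence
    the coefficient at 1 occurs n times in the fourth moment. *)
Lemma fourier_rotate w i : (w < n)%N -> (i < n)%N ->
  fourier R (weight_class n w) (2 ^+ i) = fourier R (weight_class n w) (2 ^+ 0).
Proof.
move=> wn i_n; have N0 : N%:R != 0 :> R by rewrite gt_eqF// mersenne_pos.
rewrite (fourier_weight_class (val_pow2 i_n) wn).
rewrite (fourier_weight_class (val_pow2 (ltnW n_gt1)) wn).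
congr (_ * (_ * _)); apply: eq_bigr => k _; congr (_ * _).
move: (expi _) => z.
have [m nE] : {m | n = m.+1} by exists n.-1; rewrite prednK// ltnW.
have waveD j l : wave j (2 ^ l) = wave (l + j) 1.
  by rewrite /wave natrX exprD; congr expi; ring.
under eq_bigr do rewrite waveD; under [RHS]eq_bigr do rewrite waveD add0n.
elim: i {i_n} => [|i <-]; first by under eq_bigr do rewrite add0n.
have wave_period : wave (i.+1 + m) 1 = wave (i + 0) 1.
  rewrite /wave addSnnS -nE addn0 exprD -(mersenne_natr R n).
  have -> : - (2 * pi * (2 ^+ i * (N%:R + 1)) * 1%:R / N%:R) =
    - (2 * pi * 2 ^+ i * 1%:R / N%:R) + - (2 * pi * (2 ^ i)%N%:Z%:~R) :> R.
    by rewrite -pmulrn natrX; field.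
  by rewrite expiD [X in _ * X]expiN expi_2pi_int conjc1 mulr1.
rewrite -!(big_mkord xpredT (fun j => 1 + z * wave (_ + j) 1)).
rewrite nE big_nat_recr//= big_nat_recl//= wave_period mulrC.
by congr (_ * _); apply: eq_bigr => j _; rewrite addSnnS.
Qed.

End FourierFormula.

(** * Upper bound for the fourth moment *)

Section UpperBound.
Variables (R : realType) (n : nat).
Hypothesis n_ge5 : (5 <= n)%N.
Local Notation N := (mersenne n).
Local Notation angle := (@half_angle R n).
Local Notation half_phase := (@half_phase R n).

Let n_gt1 : (1 < n)%N. Proof. exact: leq_trans n_ge5. Qed.
Let n0 : 0 < n%:R :> R. Proof. by rewrite ltr0n ltnW. Qed.

(** Weights for Hoelder's inequality: heavy enough to dominate the decay in k
    of the fourth root of sum_cos4prod_le, and with a sum of order sqrt n. *)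
Definition lorentz (k : nat) : R := (1 + n%:R * sin (half_phase k) ^+ 2)^-1.

Lemma lorentz_den_gt0 k : 0 < 1 + n%:R * sin (half_phase k) ^+ 2.
Proof. by have := mulr_ge0 (ltW n0) (sqr_ge0 (sin (half_phase k))); lra. Qed.

Lemma lorentz_gt0 k : 0 < lorentz k.
Proof. by rewrite invr_gt0 lorentz_den_gt0. Qed.

(** With 1 + n <= 5 (6/5)^n the polynomial factor is at most
    5^6 ((6/5)^6)^n, and (6/5)^6 (8/27) < 1. *)
Lemma polynomial_mul_exp_le (y : R) : 0 <= y <= n%:R ->
  (1 + y) ^+ 4 * n%:R ^+ 2 * (8 / 27) ^+ n <= 5 ^+ 6.
Proof.
move=> /andP[y0 yn].
apply: (@le_trans _ _ ((1 + n%:R) ^+ 6 * (8 / 27) ^+ n)).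
  rewrite ler_wpM2r ?exprn_ge0//; first lra.
  have -> : 6%N = (4 + 2)%N by []. rewrite exprD ler_pM ?exprn_ge0//; first lra.
    by apply: lerXn2r; rewrite ?nnegrE; lra.
  by apply: lerXn2r; rewrite ?nnegrE; lra.
have b : (1 + n%:R) <= 5 * (6 / 5) ^+ n :> R.
  have q0 : 0 <= 5^-1 :> R by rewrite invr_ge0.
  have := bernoulli_ge n q0.
  have -> : 1 + 5^-1 = 6 / 5 :> R by field.
  by lra.
have b6 : (1 + n%:R) ^+ 6 <= 5 ^+ 6 * ((6 / 5) ^+ 6) ^+ n :> R.
  rewrite -exprM mulnC exprM -exprMn; apply: lerXn2r => //; rewrite nnegrE; first lra.
  by rewrite mulr_ge0// exprn_ge0//; lra.
apply: (@le_trans _ _ (5 ^+ 6 * ((6 / 5) ^+ 6) ^+ n * (8 / 27) ^+ n)).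
  by rewrite ler_wpM2r// exprn_ge0//; lra.
rewrite -mulrA -exprMn ler_piMr ?exprn_ge0// exprn_ile1//; lra.
Qed.

(** With q = s^2 / 48 one has 1 - s^2 / 8 = 1 - 6 q <= (1 - q)^6, and
    (1 - q)^n (1 + n q) <= 1 by bernoulli_le. *)
Lemma gaussian_decay_le (s : R) : s ^+ 2 <= 1 ->
  (1 + n%:R * s ^+ 2) ^+ 6 * (1 - s ^+ 2 / 8) ^+ n <= 48 ^+ 6.
Proof.
move=> s1; set q := s ^+ 2 / 48.
have s0 := sqr_ge0 s.
have q0 : 0 <= q by rewrite /q; lra.
have q1 : q <= 1 by rewrite /q; lra.
have nq := mulr_ge0 (ltW n0) q0.
have d6 : 1 - s ^+ 2 / 8 <= (1 - q) ^+ 6.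
  have -> : s ^+ 2 / 8 = 6 * q by rewrite /q; field.
  have p2 : 1 - 2 * q <= (1 - q) ^+ 2 by nra.
  have -> : 6%N = (2 * 3)%N by []. rewrite exprM.
  apply: (@le_trans _ _ ((1 - 2 * q) ^+ 3)); last first.
    apply: lerXn2r => //; rewrite nnegrE ?sqr_ge0//; rewrite /q; lra.
  rewrite -subr_ge0.
  have -> : (1 - 2 * q) ^+ 3 - (1 - 6 * q) = 4 * q ^+ 2 * (3 - 2 * q) by ring.
  by apply: mulr_ge0; [apply: mulr_ge0 => //; exact: sqr_ge0|lra].
have dn : (1 - s ^+ 2 / 8) ^+ n <= ((1 - q) ^+ n) ^+ 6.
  rewrite -exprM mulnC exprM; apply: lerXn2r => //; rewrite nnegrE; first lra.
  by rewrite exprn_ge0//; lra.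
have y48 : 1 + n%:R * s ^+ 2 <= 48 * (1 + n%:R * q).
  have -> : s ^+ 2 = 48 * q by rewrite /q; field.
  by lra.
have y0 : 0 <= n%:R * s ^+ 2 by rewrite mulr_ge0// ltW.
apply: (@le_trans _ _ ((48 * (1 + n%:R * q)) ^+ 6 * ((1 - q) ^+ n) ^+ 6)).
  apply: ler_pM => //; rewrite ?exprn_ge0//; try lra.
  by apply: lerXn2r => //; rewrite nnegrE; lra.
rewrite exprMn -mulrA ler_piMr ?exprn_ge0// -exprMn exprn_ile1//.
  by rewrite mulr_ge0 ?exprn_ge0//; lra.
by rewrite mulrC bernoulli_le// q0 q1.
Qed.

Definition spectral_const : R := 32 * (5 ^+ 6 + 272 * 48 ^+ 6).

(** Of the six powers of 1 + n s^2 that the decay absorbs, two pay for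
    s^4 = (n s^2)^2 / n^2 and four give the weights. *)
Lemma sum_cos4prod_le_lorentz k :
  \sum_(t : residue n | t != 0) cos4prod n (half_phase k) (angle t) <=
  spectral_const / n%:R * lorentz k ^+ 4.
Proof.
apply: (le_trans (sum_cos4prod_le n_gt1 _)).
rewrite /lorentz /decay; set s := sin _.
have s0 := sqr_ge0 s.
have s1 : s ^+ 2 <= 1 by have := sqr_ge0 (cos (half_phase k)); rewrite cos2sin2 -/s; lra.
have y0 : 0 <= n%:R * s ^+ 2 by rewrite mulr_ge0// ltW.
have y1 : n%:R * s ^+ 2 <= n%:R by rewrite ler_piMr// ltW.
have Y0 : 0 < (1 + n%:R * s ^+ 2) ^+ 4 by rewrite exprn_gt0//; lra.
rewrite exprVn ler_pdivlMr// -(ler_pM2r n0).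
have -> : spectral_const / n%:R * n%:R = spectral_const by rewrite divfK// gt_eqF.
have e1 := @polynomial_mul_exp_le (n%:R * s ^+ 2).
rewrite y0 y1 in e1; have {}e1 := e1 isT.
have e2 := gaussian_decay_le s1.
have e3 : n%:R ^+ 2 * s ^+ 4 * (1 + n%:R * s ^+ 2) ^+ 4 * (1 - s ^+ 2 / 8) ^+ n <= 48 ^+ 6.
  apply: le_trans e2; rewrite ler_wpM2r ?exprn_ge0//; first lra.
  have -> : n%:R ^+ 2 * s ^+ 4 = (n%:R * s ^+ 2) ^+ 2 by ring.
  have -> : (1 + n%:R * s ^+ 2) ^+ 6 = (1 + n%:R * s ^+ 2) ^+ 2 * (1 + n%:R * s ^+ 2) ^+ 4.
    by rewrite -exprD.
  rewrite ler_wpM2r ?exprn_ge0//; first lra.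
  by apply: lerXn2r; rewrite ?nnegrE; lra.
rewrite /spectral_const.
move: e1 e3; move: ((1 - s ^+ 2 / 8) ^+ n) ((8 / 27) ^+ n) ((1 + n%:R * s ^+ 2) ^+ 4).
move=> T E Y; move: (5 ^+ 6) (48 ^+ 6) => a b e1 e3.
have -> : 32 * n%:R * (E + 272 * s ^+ 4 * T) * Y * n%:R =
  32 * (Y * n%:R ^+ 2 * E + 272 * (n%:R ^+ 2 * s ^+ 4 * Y * T)) by ring.
lra.
Qed.

Let r : R := Num.sqrt (2 * n%:R).

Let r_sqr : r ^+ 2 = 2 * n%:R.
Proof. by rewrite sqr_sqrtr// mulr_ge0// ltW. Qed.

Let r_ge2 : 2 <= r.
Proof.
have r0 : 0 <= r by rewrite sqrtr_ge0.
have n5 : 5 <= n%:R :> R by rewrite (ler_nat R 5).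
by have := r_sqr; nra.
Qed.

(** Each term is at most 2 r^2 / ((r - 1 + k) (r + k)), which telescopes. *)
Lemma cauchy_sum_le M :
  \sum_(k < M) (1 + (k%:R / r) ^+ 2)^-1 <= 2 * r ^+ 2 * ((r - 1)^-1 - (r - 1 + M%:R)^-1).
Proof.
have r2 := r_ge2.
elim: M => [|M IH]; first by rewrite big_ord0 addr0 subrr mulr0.
rewrite big_ord_recr /=.
have M0 := ler0n R M; rewrite -(natr1 M).
have r1 : 0 < r - 1 + M%:R by lra.
have r3 : 0 < r - 1 + (M%:R + 1) by lra.
suff : (1 + (M%:R / r) ^+ 2)^-1 <= 2 * r ^+ 2 * ((r - 1 + M%:R)^-1 - (r - 1 + (M%:R + 1))^-1).
  by move=> h; apply: (le_trans (lerD IH h)); rewrite -mulrDr; lra.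
have rr : 0 < r by lra.
have -> : (1 + (M%:R / r) ^+ 2)^-1 = r ^+ 2 / (r ^+ 2 + M%:R ^+ 2).
  have rr2 : 0 < r ^+ 2 by rewrite exprn_gt0.
  have d0 : r ^+ 2 + M%:R ^+ 2 != 0 by rewrite gt_eqF//; have := sqr_ge0 (M%:R : R); lra.
  have r0 : r != 0 by rewrite gt_eqF.
  rewrite expr_div_n; move: (M%:R : R) d0 => m d0; field.
  by rewrite r0 d0.
have -> : 2 * r ^+ 2 * ((r - 1 + M%:R)^-1 - (r - 1 + (M%:R + 1))^-1) =
    r ^+ 2 * (2 / ((r - 1 + M%:R) * (r + M%:R))).
  by field; apply/andP; split; rewrite gt_eqF//; lra.
rewrite ler_pM2l ?exprn_gt0//.
rewrite ler_pdivlMr; last by rewrite mulr_gt0//; lra.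
rewrite mulrC ler_pdivrMr; last by nra.
by have := sqr_ge0 (r - M%:R); nra.
Qed.

(** The phase is pi k / (n + 1), and sin is symmetric about pi / 2; on each
    half of the range it is bounded below by half_le_sin. *)
Lemma lorentz_le k : (k <= n.+1)%N ->
  lorentz k <= (1 + (k%:R / r) ^+ 2)^-1 + (1 + ((n.+1 - k)%:R / r) ^+ 2)^-1.
Proof.
move=> kn; have r2 := r_ge2; have pi0 := pi_gt0 R.
have m0 : 0 < n.+1%:R :> R by rewrite ltr0n.
have key (x : R) : 0 <= x -> x / n.+1%:R <= sin (half_phase k) ->
    lorentz k <= (1 + (x / r) ^+ 2)^-1.
  move=> x0 xs; rewrite /lorentz lef_pV2 ?posrE ?lorentz_den_gt0//; last first.
    by have := sqr_ge0 (x / r); lra.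
  rewrite lerD2l.
  apply: (@le_trans _ _ (n%:R * (x / n.+1%:R) ^+ 2)); last first.
    have xm : 0 <= x / n.+1%:R by rewrite divr_ge0// ltW.
    by rewrite ler_pM2l//; apply: lerXn2r => //; rewrite nnegrE// (le_trans xm).
  rewrite !expr_div_n r_sqr mulrA ler_pdivlMr ?exprn_gt0// mulrAC ler_pdivrMr; last by rewrite mulr_gt0.
  have : n.+1%:R ^+ 2 <= 2 * n%:R ^+ 2 :> R.
    by rewrite -!natrX -natrM ler_nat; nia.
  by have := sqr_ge0 x; nra.
have V0 (y : R) : 0 <= (1 + (y / r) ^+ 2)^-1.
  by rewrite invr_ge0; have := sqr_ge0 (y / r); lra.
have pi2 := pi_ge2 R.
have kn' : k%:R <= n.+1%:R :> R by rewrite ler_nat.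
case: (leP (k%:R * 2) (n.+1%:R : R)) => h.
  rewrite -[leLHS]addr0 lerD// key//.
  have x0 : 0 <= half_phase k by rewrite divr_ge0 ?mulr_ge0// ltW.
  apply: le_trans (half_le_sin _); last first.
    rewrite x0 /= /half_phase ler_pdivrMr//; nra.
  rewrite /half_phase ler_pdivrMr//.
  have -> : pi * k%:R / n.+1%:R / 2 * n.+1%:R = pi / 2 * k%:R :> R.
    by rewrite mulrAC divfK ?gt_eqF// mulrAC.
  by have := ler0n R k; nra.
rewrite -[leLHS]add0r lerD// key//.
have -> : sin (half_phase k) = sin (pi * (n.+1 - k)%:R / n.+1%:R).
  have -> : half_phase k = - (pi * (n.+1 - k)%:R / n.+1%:R) + pi.
    rewrite natrB// /half_phase; move: n.+1%:R m0 => m m0.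
    by field; rewrite gt_eqF.
  by rewrite sinDpi sinN opprK.
have x0 : 0 <= pi * (n.+1 - k)%:R / n.+1%:R :> R.
  by rewrite divr_ge0 ?mulr_ge0// ltW.
apply: le_trans (half_le_sin _); last first.
  rewrite x0 /= ler_pdivrMr// natrB//; nra.
rewrite ler_pdivrMr//.
have -> : pi * (n.+1 - k)%:R / n.+1%:R / 2 * n.+1%:R = pi / 2 * (n.+1 - k)%:R :> R.
  by rewrite mulrAC divfK ?gt_eqF// mulrAC.
by have := ler0n R (n.+1 - k); nra.
Qed.

Lemma sum_lorentz_le : \sum_(k < n.+1) lorentz k <= 8 * r.
Proof.
have r2 := r_ge2.
pose v (k : nat) := (1 + (k%:R / r) ^+ 2)^-1.
have v0 k : 0 <= v k by rewrite invr_ge0; have := sqr_ge0 (k%:R / r); lra.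
have sv : \sum_(k < n.+2) v k <= 4 * r.
  apply: (le_trans (cauchy_sum_le _)).
  have M0 := ler0n R n.+2.
  apply: (@le_trans _ _ (2 * r ^+ 2 * (r - 1)^-1)).
    apply: ler_wpM2l; first by have := sqr_ge0 r; lra.
    by rewrite gerBl invr_ge0; lra.
  by rewrite ler_pdivrMr; [nra|lra].
apply: (@le_trans _ _ (\sum_(k < n.+2) (v k + v (n.+1 - k)%N))).
  rewrite [leRHS]big_ord_recr /= -[leLHS]addr0 lerD//; last exact: addr_ge0.
  by apply: ler_sum => k _; apply: lorentz_le; rewrite ltnW.
rewrite big_split /=.
have -> : \sum_(k < n.+2) v (n.+1 - k)%N = \sum_(k < n.+2) v k.
  by rewrite [RHS](reindex_inj rev_ord_inj).
lra.
Qed.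

Lemma modulus_fourier_le (t : residue n) w : (w < n)%N ->
  modulus (fourier R (weight_class n w) t) ^+ 4 <=
  16 * (n.+1%:R^-1) ^+ 4 * ((\sum_(k < n.+1) lorentz k) ^+ 3 *
     \sum_(k < n.+1) cos4prod n (half_phase k) (angle t) / lorentz k ^+ 3).
Proof.
move=> wn; have N0 := mersenne_pos R n_gt1.
rewrite (fourier_weight_class R n_gt1 (erefl _) wn) /modulus !Normc.normcM !normc_natV.
rewrite !exprMn mulrA.
set a := fun k : 'I_n.+1 => Normc.normc
  (\prod_(j < n) (1 + expi (2 * pi * k%:R / n.+1%:R) * wave R n j t)).
have a0 k : 0 <= a k by exact: normc_nonneg.
have le1 : Normc.normc (\sum_(k < n.+1) expi (- (2 * pi * k%:R * w%:R / n.+1%:R)) *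
    \prod_(j < n) (1 + expi (2 * pi * k%:R / n.+1%:R) * wave R n j t)) <= \sum_k a k.
  apply: (le_trans (normc_sum_le _ _ _)); apply: ler_sum => k _.
  by rewrite Normc.normcM normc_expi mul1r.
set A := Normc.normc (\sum_k _) in le1 *.
have le4 : A ^+ 4 <= (\sum_(k < n.+1) lorentz k) ^+ 3 * \sum_k a k ^+ 4 / lorentz k ^+ 3.
  apply: le_trans (weighted_power_mean (fun k : 'I_n.+1 => lorentz_gt0 k) a0).
  by apply: lerXn2r => //; rewrite nnegrE ?sumr_ge0//; exact: normc_nonneg.
have p2 : (2 ^+ n / N%:R) ^+ 4 <= 16 :> R.
  rewrite (_ : 16 = 2 ^+ 4); last by rewrite -natrX.
  apply: lerXn2r; rewrite ?nnegrE// ?divr_ge0 ?exprn_ge0//.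
  rewrite ler_pdivrMr// -(mersenne_natr R n).
  by have : 1 <= N%:R :> R; [rewrite ler1n ltnW// mersenne_gt1 | lra].
have aE k : a k ^+ 4 / lorentz k ^+ 3 =
    (2 ^+ n) ^+ 4 * (cos4prod n (half_phase k) (angle t) / lorentz k ^+ 3).
  by rewrite mulrA /a normc_prod_wave.
move: le4; under [X in _ <= _ * X]eq_bigr do rewrite aE.
rewrite -mulr_sumr => le4.
set W := \sum_(k < n.+1) lorentz k in le4 *.
set S := \sum_(k < n.+1) _ / _ in le4 *.
have W0 : 0 <= W by apply: sumr_ge0 => k _; apply: ltW; exact: lorentz_gt0.
have S0 : 0 <= S.
  by apply: sumr_ge0 => k _; rewrite divr_ge0 ?cos4prod_ge0// exprn_ge0// ltW// lorentz_gt0.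
have M0 : 0 <= (n.+1%:R^-1) ^+ 4 :> R by rewrite exprn_ge0// invr_ge0.
have Ni : 0 <= N%:R^-1 ^+ 4 :> R by rewrite exprn_ge0// invr_ge0.
apply: (@le_trans _ _ ((2 ^+ n / N%:R) ^+ 4 * ((n.+1%:R^-1) ^+ 4 * (W ^+ 3 * S)))).
  have := ler_wpM2l (mulr_ge0 Ni M0) le4; rewrite mulrA => h; apply: (le_trans h).
  by rewrite le_eqVlt; apply/orP; left; apply/eqP; ring.
rewrite -mulrA ler_wpM2r//; apply: mulr_ge0 => //; apply: mulr_ge0 => //.
exact: exprn_ge0.
Qed.

(** Of the n^(-3), the normalization (n + 1)^(-4) of the filter, the
    fourth power O(n^2) of the total weight and the 1 / n of
    sum_cos4prod_le_lorentz contribute -4, 2 and -1 to the exponent. *)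
Lemma sum_fourier4_le w : (w < n)%N ->
  \sum_(t : residue n | t != 0) modulus (fourier R (weight_class n w) t) ^+ 4 <=
  2 ^+ 18 * spectral_const * n%:R ^- 3.
Proof.
move=> wn; have r2 := r_ge2.
set W := \sum_(k < n.+1) lorentz k.
have W0 : 0 <= W by apply: sumr_ge0 => k _; apply: ltW; exact: lorentz_gt0.
have W8 : W <= 8 * r := sum_lorentz_le.
have C0 : 0 <= spectral_const by rewrite /spectral_const mulr_ge0// addr_ge0// ?mulr_ge0// exprn_ge0.
set m4 := (n.+1%:R^-1) ^+ 4 : R.
have m40 : 0 <= m4 by rewrite exprn_ge0// invr_ge0.
apply: (@le_trans _ _ (16 * m4 * (W ^+ 3 * (spectral_const / n%:R * W)))).
  apply: (le_trans (ler_sum _ (fun t _ => modulus_fourier_le t wn))).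
  rewrite -!mulr_sumr exchange_big /= -/m4 -/W.
  apply: ler_wpM2l; first exact: mulr_ge0.
  apply: ler_wpM2l; first exact: exprn_ge0.
  rewrite mulr_sumr; apply: ler_sum => k _; rewrite -mulr_suml.
  have w0 := lorentz_gt0 k.
  rewrite ler_pdivrMr ?exprn_gt0// -(mulrA _ (lorentz k)) -exprS.
  exact: sum_cos4prod_le_lorentz.
have W4 : W ^+ 4 <= 2 ^+ 14 * n%:R ^+ 2.
  have -> : 2 ^+ 14 * n%:R ^+ 2 = (8 * r) ^+ 4.
    by rewrite exprMn (exprM r 2 2) r_sqr; ring.
  by apply: lerXn2r => //; rewrite nnegrE; lra.
have m4n : m4 <= n%:R ^- 4.
  rewrite /m4 -exprVn; apply: lerXn2r; rewrite ?nnegrE ?invr_ge0//.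
  by rewrite lef_pV2 ?posrE// ler_nat.
have -> : 16 * m4 * (W ^+ 3 * (spectral_const / n%:R * W)) =
  16 * spectral_const / n%:R * (m4 * W ^+ 4) by ring.
have -> : 2 ^+ 18 * spectral_const * n%:R ^- 3 =
  16 * spectral_const / n%:R * (n%:R ^- 4 * (2 ^+ 14 * n%:R ^+ 2)).
  by field; rewrite gt_eqF.
apply: ler_wpM2l; first by apply: divr_ge0; [exact: mulr_ge0|exact: ltW].
apply: ler_pM => //; exact: exprn_ge0.
Qed.

End UpperBound.

(** * Additive energy and the fourth moment *)

Section Energy.
Variables (R : realType) (n : nat).
Hypothesis n_gt1 : (1 < n)%N.
Local Notation N := (mersenne n).
Implicit Types (S : {set residue n}) (t : residue n).

Definition character (x t : nat) : R[i] := expi (- (2 * pi * x%:R * t%:R / N%:R)).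

Definition char_sum S t := \sum_(x in S) character x t.

Lemma modulus_fourier S t :
  modulus (fourier R S t) = N%:R^-1 * Normc.normc (char_sum S t).
Proof. by rewrite /modulus /fourier Normc.normcM normc_natV. Qed.

Lemma sqr_normc (z : R[i]) : ((Normc.normc z) ^+ 2)%:C = z * conjc z.
Proof.
case: z => x y; rewrite sqr_sqrtr ?addr_ge0 ?sqr_ge0//.
by apply/eqP; rewrite eq_complex /=; apply/andP; split; apply/eqP; ring.
Qed.

Lemma dvdz_residue (a b c d : residue n) :
  (N %| (c : nat)%:Z + (d : nat)%:Z - (a : nat)%:Z - (b : nat)%:Z)%Z = (a + b == c + d).
Proof.
rewrite -[a in RHS]natr_Zp -[b in RHS]natr_Zp -[c in RHS]natr_Zp -[d in RHS]natr_Zp.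
rewrite -!natrD -val_eqE /= !val_Zp_nat ?mersenne_gt1//.
rewrite eq_sym -eqz_nat -!modz_nat eqz_mod_dvd !PoszD.
by rewrite opprD addrA.
Qed.

(** The fourth power is the sum of the characters of c + d - a - b over
    quadruples; orthogonality keeps those with a + b = c + d. *)
Lemma sum_normc_char_sum S :
  \sum_(t : residue n) ((Normc.normc (char_sum S t)) ^+ 4)%:C = N%:R * (energy S)%:R.
Proof.
have expand t : ((Normc.normc (char_sum S t)) ^+ 4)%:C =
    \sum_(q : residue n * residue n * residue n * residue n |
      [&& q.1.1.1 \in S, q.1.1.2 \in S, q.1.2 \in S & q.2 \in S])
      expi (2 * pi * ((q.1.2 : nat)%:Z + (q.2 : nat)%:Z
         - (q.1.1.1 : nat)%:Z - (q.1.1.2 : nat)%:Z)%:~R * t%:R / N%:R).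
  rewrite (exprM _ 2 2) rmorphXn /= sqr_normc.
  have -> : (char_sum S t * conjc (char_sum S t)) ^+ 2 =
    char_sum S t * char_sum S t * conjc (char_sum S t) * conjc (char_sum S t) by ring.
  have -> : conjc (char_sum S t) =
      \sum_(x in S) expi (2 * pi * (x : nat)%:R * (t : nat)%:R / N%:R).
    rewrite /char_sum rmorph_sum; apply: eq_bigr => x _.
    by rewrite /character expiN; exact: conjcK.
  rewrite /char_sum.
  rewrite big_distrlr pair_big /= big_distrlr pair_big /= big_distrlr pair_big /=.
  apply: eq_big => [[[[a b] c] d]|[[[a b] c] d] _] /=; first by rewrite -!andbA.
  rewrite /character -!expiD; congr expi.
  rewrite !rmorphB rmorphD /= -!pmulrn; field.
  by rewrite gt_eqF// mersenne_pos.
under eq_bigr do rewrite expand.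
rewrite exchange_big /=.
under eq_bigr do rewrite sum_expi_residue// dvdz_residue.
rewrite -big_mkcondr /= sumr_const -(mulr_natr N%:R); congr (_ * _%:R).
rewrite /energy; apply: eq_card => -[[[a b] c] d]; rewrite inE.
by rewrite unfold_in /= -!andbA.
Qed.

Lemma energy_fourier S :
  (energy S)%:R = N%:R ^+ 3 * \sum_(t : residue n) modulus (fourier R S t) ^+ 4.
Proof.
have N0 : N%:R != 0 :> R by rewrite gt_eqF// mersenne_pos.
under eq_bigr do rewrite modulus_fourier exprMn.
rewrite -mulr_sumr.
have -> : \sum_(t : residue n) Normc.normc (char_sum S t) ^+ 4 = N%:R * (energy S)%:R.
  by apply: complexI; rewrite rmorph_sum rmorphM /= !rmorph_nat sum_normc_char_sum.
by move: N%:R N0 => M M0; field.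
Qed.

Lemma modulus_fourier0 S : modulus (fourier R S 0) = #|S|%:R / N%:R.
Proof.
rewrite modulus_fourier mulrC; congr (_ / _).
have -> : char_sum S 0 = #|S|%:R.
  rewrite /char_sum /character; under eq_bigr do rewrite mulr0 mul0r oppr0 expi0.
  by rewrite sumr_const.
by rewrite -(rmorph_nat (real_complex R)) /= expr0n addr0 sqrtr_sqr ger0_norm.
Qed.

Lemma energy_excess S : (energy S)%:R - #|S|%:R ^+ 4 / N%:R =
  N%:R ^+ 3 * \sum_(t : residue n | t != 0) modulus (fourier R S t) ^+ 4.
Proof.
have N0 : N%:R != 0 :> R by rewrite gt_eqF// mersenne_pos.
rewrite energy_fourier (bigD1 0)//= modulus_fourier0 mulrDr.
by move: N%:R N0 (\sum_(t | _) _) => M M0 s; field.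
Qed.

(** If all coefficients at t != 0 vanish, Fourier inversion makes the indicator
    function of S constant; evaluating it at x0 gives |S| = 0. *)
Lemma fourier4_pos S x0 : x0 \notin S -> (0 < #|S|)%N ->
  0 < \sum_(t : residue n | t != 0) modulus (fourier R S t) ^+ 4.
Proof.
move=> x0S S0.
have m0 t : 0 <= modulus (fourier R S t) ^+ 4 by rewrite exprn_ge0// normc_nonneg.
rewrite lt0r sumr_ge0// andbT psumr_eq0//; apply: contraL S0 => /allP all0.
have f0 t : t != 0 -> char_sum S t = 0.
  move=> t0; apply: Normc.eq0_normc.
  have := all0 t; rewrite mem_index_enum t0 => /(_ isT).
  rewrite expf_eq0 /= modulus_fourier mulf_eq0 invr_eq0 gt_eqF ?mersenne_pos//=.
  by move/eqP.
have inversion : \sum_(t : residue n)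
    char_sum S t * expi (2 * pi * (x0 : nat)%:R * (t : nat)%:R / N%:R) = 0.
  rewrite /char_sum; under eq_bigr do rewrite mulr_suml.
  rewrite exchange_big /= big1// => a aS.
  transitivity (\sum_(t : residue n)
      expi (2 * pi * ((x0 : nat)%:Z + 0%N%:Z - (a : nat)%:Z - 0%N%:Z)%:~R
        * (t : nat)%:R / N%:R) : R[i]).
    apply: eq_bigr => t _; rewrite /character -expiD; congr expi.
    rewrite !rmorphB rmorphD /= -!pmulrn; field.
    by rewrite gt_eqF// mersenne_pos.
  rewrite sum_expi_residue// (dvdz_residue a 0 x0 0) !addr0.
  by case: eqP => // ax; move: x0S; rewrite -ax aS.
move: inversion; rewrite (bigD1 0)//= big1 => [|t t0]; last by rewrite f0// mul0r.
rewrite mulr0 mul0r expi0 mulr1 addr0 => /eqP.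
have -> : char_sum S 0 = #|S|%:R.
  rewrite /char_sum /character; under eq_bigr do rewrite mulr0 mul0r oppr0 expi0.
  by rewrite sumr_const.
by rewrite pnatr_eq0 => /eqP ->.
Qed.

End Energy.

(** * The Fourier coefficient at 1 *)

Section RemoveOne.
Variables (I : finType) (V : nmodType).

(** The map removing i is a bijection from the sets containing i to those that
    do not contain it. *)
Lemma sum_remove1 (i : I) (P : pred {set I}) (F : {set I} -> V) :
  \sum_(A : {set I} | (i \in A) && P (A :\ i)) F (A :\ i) =
  \sum_(B : {set I} | (i \notin B) && P B) F B.
Proof.
rewrite (reindex_onto (fun B => i |: B) (fun A => A :\ i)) /= => [|A /andP[iA _]]; last first.
  by rewrite setD1K.
apply: eq_big => [B|B /andP[_ /eqP->]//].
rewrite setU11 /=; case: (boolP (i \in B)) => iB /=.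
  by apply/negbTE; rewrite negb_and orbC; apply/orP; left;
     apply/eqP => /setP/(_ i); rewrite setD11 iB.
by rewrite setU1K// eqxx andbT.
Qed.

End RemoveOne.

Section SineGap.
Variables (R : realType) (m w : nat).
Local Notation n := m.+3.
Hypothesis w_lt : (w < m.+2)%N.
Hypothesis n_le_2w : (n <= 2 * w.+1)%N.
Local Notation N := (mersenne n).

Let n_gt1 : (1 < n)%N. Proof. by []. Qed.
Let top : 'I_n := inord m.+2.
Let second : 'I_n := inord m.+1.
Let third : 'I_n := inord m.

Definition turn_sin (y : R) := sin (2 * pi * y / N%:R).

(** Without the top digit the value is less than N / 2, so that the sine is
    nonnegative. *)
Definition lower_half (A : {set 'I_n}) k := (#|A| == k) && (top \notin A).

(** The contribution of residues without the top digit to the sum of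
    sin (2 pi x / N) over the weight class. *)
Definition upper_sines := \sum_(A | lower_half A w.+1) turn_sin (set_val A)%:R.
(** Minus the contribution of residues with the top digit, which is removed:
    since 2^(n - 1) = N / 2 + 1 / 2, adding it is half a turn, up to the
    shift 1/2. *)
Definition shifted_sines := \sum_(A | lower_half A w) turn_sin ((set_val A)%:R + 2^-1).

Let N0 : 0 < N%:R :> R. Proof. exact: mersenne_pos. Qed.

Lemma natr_mersenne : N%:R = 8 * 2 ^+ m - 1 :> R.
Proof. by apply: (addIr 1); rewrite (mersenne_natr R n) !exprS subrK; ring. Qed.

Lemma set_val_add1 i (A : {set 'I_n}) : i \in A ->
  set_val A = (2 ^ i + set_val (A :\ i))%N.
Proof. by move=> iA; rewrite /set_val (big_setD1 i). Qed.

Lemma turn_sin_half_turn y : turn_sin (y + 2 ^+ m.+2) = - turn_sin (y + 2^-1).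
Proof.
rewrite /turn_sin -sinDpi; congr sin.
have -> : 2 ^+ m.+2 = (N%:R + 1) / 2 :> R by rewrite natr_mersenne !exprS; field.
by field; rewrite gt_eqF.
Qed.

Lemma sum_turn_sin_weight_class :
  \sum_(x in weight_class n w.+1) turn_sin (x : nat)%:R = upper_sines - shifted_sines.
Proof.
rewrite (sum_weight_class n_gt1 (fun x => turn_sin x%:R)) 1?ltnS//.
rewrite (bigID (fun A : {set _} => top \in A)) /= addrC; congr (_ + _).
rewrite /shifted_sines -sumrN.
transitivity (\sum_(A : {set 'I_n} | (top \in A) && (#|A :\ top| == w))
   - turn_sin ((set_val (A :\ top))%:R + 2^-1)).
  apply: eq_big => [A|A /andP[_ tA]].
    rewrite andbC; case: (boolP (top \in A)) => //= tA.
    by rewrite (cardsD1 top A) tA.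
  rewrite -turn_sin_half_turn (set_val_add1 tA) inordK// natrD natrX.
  by rewrite addrC.
rewrite (sum_remove1 top (fun B => #|B| == w) (fun B => - turn_sin ((set_val B)%:R + 2^-1))).
by apply: eq_bigl => B; rewrite /lower_half andbC.
Qed.

Lemma set_val_lower_half A k : lower_half A k -> (set_val A < 2 ^ m.+2)%N.
Proof.
move=> /andP[_ tA]; have := set_val_lt (top |: A).
rewrite (set_val_add1 (setU11 _ _)) setU1K// inordK// [(2 ^ n)%N]expnS.
lia.
Qed.

Lemma upper_phase A k : lower_half A k -> 2 * pi * (set_val A)%:R / N%:R <= pi :> R.
Proof.
move=> /set_val_lower_half; rewrite -(ler_nat R) -natr1 natrX => h.
have -> : 2 * pi * (set_val A)%:R / N%:R = pi * (2 * (set_val A)%:R / N%:R) :> R by ring.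
rewrite ler_piMr ?pi_ge0// ler_pdivrMr// natr_mersenne; move: h; rewrite !exprS; lra.
Qed.

Lemma turn_sin_lower_half_ge0 A k : lower_half A k -> 0 <= turn_sin (set_val A)%:R.
Proof.
move=> /upper_phase h; apply: sin_ge0_pi; rewrite h andbT.
by rewrite divr_ge0 ?mulr_ge0 ?pi_ge0// ltW.
Qed.

(** The shift 1/2 is absorbed because |2^i - 1/2| <= 2^i. *)
Lemma turn_sin_remove1 (A : {set 'I_n}) i : i \in A ->
  turn_sin (set_val A)%:R - 2 * pi * (2 ^ i)%:R / N%:R <= turn_sin ((set_val (A :\ i))%:R + 2^-1).
Proof.
move=> iA; rewrite lerBlDr -lerBlDl; apply: (le_trans (ler_norm _)).
apply: (le_trans (sin_lipschitz _ _)).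
rewrite (set_val_add1 iA) natrD.
have -> : 2 * pi * ((2 ^ i)%:R + (set_val (A :\ i))%:R) / N%:R -
   2 * pi * ((set_val (A :\ i))%:R + 2^-1) / N%:R =
   2 * pi * ((2 ^ i)%:R - 2^-1) / N%:R :> R by field; rewrite gt_eqF.
have i1 : 1 <= (2 ^ i)%:R :> R by rewrite ler1n expn_gt0.
rewrite ger0_norm; last by rewrite divr_ge0 ?mulr_ge0 ?pi_ge0//; lra.
by rewrite ler_pM2r ?invr_gt0// ler_pM2l ?mulr_gt0 ?pi_gt0//; lra.
Qed.

(** Pairs of a set and one of its elements, counted after removal: a set B of
    w positions arises from each of the n - 1 - w positions that are neither
    in B nor the top one. *)
Lemma double_count :
  \sum_(A | lower_half A w.+1) \sum_(i in A) turn_sin ((set_val (A :\ i))%:R + 2^-1) =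
  (n - w.+1)%:R * shifted_sines.
Proof.
rewrite (exchange_big_dep (fun i => i != top)) /= => [|A i]; last first.
  by move=> /andP[_ tA] iA; apply: contra tA => /eqP <-.
transitivity (\sum_(i | i != top) \sum_(B : {set _} | (i \notin B) && lower_half B w)
    turn_sin ((set_val B)%:R + 2^-1)).
  apply: eq_bigr => i it.
  rewrite -(sum_remove1 i (fun B => lower_half B w) (fun B => turn_sin ((set_val B)%:R + 2^-1))).
  apply: eq_bigl => A; rewrite andbC; case: (boolP (i \in A)) => //= iA.
  by rewrite /lower_half (cardsD1 i A) iA !inE (eq_sym top) it.
rewrite (exchange_big_dep (fun B => lower_half B w)) /= => [|i B _ /andP[]//].
rewrite /shifted_sines mulr_sumr; apply: eq_bigr => B /andP[/eqP Bw tB].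
rewrite (eq_bigl (fun i => i \in ~: (top |: B))) => [|i]; last first.
  by rewrite /lower_half Bw eqxx tB /= andbT !inE negb_or.
rewrite sumr_const mulr_natl; congr (_ *+ _).
by have := cardsC (top |: B); rewrite cardsU1 tB Bw card_ord; move: #|~: _| => c; lia.
Qed.

Lemma card_lower_half k : #|[set A | lower_half A k]| = 'C(m.+2, k).
Proof.
have cT : #|[set~ top]| = m.+2 by have := cardsC1 top; rewrite card_ord.
rewrite -[in RHS]cT -cards_draws; apply: eq_card => A; rewrite !inE /lower_half andbC.
by rewrite subsetC sub1set inE.
Qed.

(** Removing one digit at a time from a set A changes the sine by at most
    2 pi 2^i / N for each i in A, altogether at most 2 pi set_val A / N <= pi.
    So, weighted by the numbers of pairs in double_count, the second sum falls
    short of the first by at most pi for each set. *)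
Lemma shifted_sines_ge :
  w.+1%:R * upper_sines - pi * 'C(m.+2, w.+1)%:R <= (n - w.+1)%:R * shifted_sines.
Proof.
rewrite -double_count -card_lower_half -sum1dep_card natr_sum !mulr_sumr -sumrB.
apply: ler_sum => A Ah; have /andP[/eqP Aw _] := Ah.
apply: (@le_trans _ _ (\sum_(i in A) (turn_sin (set_val A)%:R - 2 * pi * (2 ^ i)%:R / N%:R))).
  rewrite sumrB sumr_const Aw mulr_natl lerD2l lerN2 mulr1.
  rewrite -mulr_suml -mulr_sumr -natr_sum; exact: upper_phase Ah.
by apply: ler_sum => i; exact: turn_sin_remove1.
Qed.

(** All terms are nonnegative. Those whose leading digits are 010 have angle
    between pi / 2 and 3 pi / 4, so their sine is at least 1/4. *)
Lemma upper_sines_ge : 4^-1 * 'C(m, w)%:R <= upper_sines.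
Proof.
have st : second != top by rewrite -val_eqE /= !inordK//; lia.
have tht : third != top by rewrite -val_eqE /= !inordK//; lia.
have ths : third != second by rewrite -val_eqE /= !inordK//; lia.
pose Q (A : {set 'I_n}) := (second \in A) && (third \notin A).
rewrite /upper_sines (bigID Q) /= -[leLHS]addr0 lerD//; last first.
  by apply: sumr_ge0 => A /andP[Ah _]; exact: turn_sin_lower_half_ge0 Ah.
pose P (B : {set 'I_n}) := [&& #|B| == w, top \notin B & third \notin B].
have count : \sum_(A : {set _} | (second \in A) && P (A :\ second)) 1 = 'C(m, w)%:R :> R.
  rewrite (sum_remove1 second P (fun=> 1)) sumr_const; congr (_%:R).
  have cT : #|~: [set top; second; third]| = m.
    have := cardsC [set top; second; third].
    by rewrite -setUA cardsU1 cards2 !inE negb_or (eq_sym top second) (eq_sym top third)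
       st tht (eq_sym second) ths card_ord /=; lia.
  rewrite -[in RHS]cT -cards_draws; apply: eq_card => B; rewrite inE.
  rewrite subsetC !subUset !sub1set !inE /P unfold_in /=.
  by rewrite -!andbA; case: (top \notin B); case: (second \notin B);
    case: (third \notin B); rewrite ?andbF ?andbT.
rewrite -count mulr_sumr mulr1.
rewrite [leLHS](eq_bigl (fun A => lower_half A w.+1 && Q A)) => [|A]; last first.
  rewrite /lower_half /Q /P; case: (boolP (second \in A)) => sA; rewrite /= ?andbF//.
  rewrite !inE (eq_sym top second) st ths (cardsD1 second A) sA /= eqSS.
  by rewrite -!andbA.
apply: ler_sum => A /andP[Ah /andP[sA thA]].
have vB : (set_val (A :\ second) < 2 ^ m)%N.
  have /andP[_ tA] := Ah.
  have := set_val_lt (top |: (second |: (third |: (A :\ second)))).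
  rewrite (set_val_add1 (setU11 _ _)) setU1K; last first.
    by rewrite !inE !negb_or (eq_sym top second) (eq_sym top third) st tht (negPf tA) andbF.
  rewrite (set_val_add1 (setU11 _ _)) setU1K; last first.
    by rewrite !inE eqxx negb_or (eq_sym second) ths.
  rewrite (set_val_add1 (setU11 _ _)) setU1K; last by rewrite !inE (negPf thA) andbF.
  rewrite !inordK//; try lia.
  rewrite !expnS; lia.
move: (upper_phase Ah); rewrite /turn_sin (set_val_add1 sA) inordK//.
rewrite natrD natrX exprS; set v := (set_val _)%:R => phase.
have v0 : 0 <= v by rewrite ler0n.
have v1 : v + 1 <= 2 ^+ m by rewrite natr1 -natrX ler_nat.
have pi0 := pi_gt0 R; have pi2 := pi_ge2 R.
set x := 2 * pi * _ / _ in phase *.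
have -> : sin x = sin (pi - x) by rewrite [pi - x]addrC sinDpi sinN opprK.
have xE : x * N%:R = 2 * pi * (2 * 2 ^+ m + v) by rewrite divfK// gt_eqF.
rewrite natr_mersenne in xE.
have a1 : 1 <= 2 ^+ m :> R by rewrite exprn_ege1// ler1n.
have D0 : 0 < 8 * 2 ^+ m - 1 :> R by lra.
have x1 : pi / 2 <= x by rewrite -(ler_pM2r D0) xE; nra.
have x2 : x <= 3 / 4 * pi by rewrite -(ler_pM2r D0) xE; nra.
by apply: le_trans (half_le_sin _); lra.
Qed.

(** The imaginary part of the coefficient at 1 is proportional to
    shifted_sines - upper_sines. For digit sum k the ratio of the two sums
    is, by shifted_sines_ge, at least k / (n - k) up to an error, and this
    exceeds 1 by (2 k - n) / (n - k): it is the slope of the binomial distribution away from its centre. *)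
Lemma modulus_fourier_unit_ge :
  (2 * w.+1%:R - n%:R) / 4 * 'C(m, w)%:R - pi * 'C(m.+2, w.+1)%:R <=
  (n - w.+1)%:R * (N%:R * modulus (fourier R (weight_class n w.+1) (2 ^+ 0))).
Proof.
have val1 : nat_of_ord (2 ^+ 0 : residue n) = 1%N.
  by rewrite expr0 -[1]/(1%:R) val_Zp_nat ?mersenne_gt1// modn_small// mersenne_gt1.
have Im_le (z : R[i]) : complex.Im z <= Normc.normc z.
  case: z => a b /=; apply: (le_trans (ler_norm _)); rewrite -sqrtr_sqr.
  by rewrite ler_sqrt ?addr_ge0 ?sqr_ge0// lerDr sqr_ge0.
have gap : shifted_sines - upper_sines <=
    N%:R * modulus (fourier R (weight_class n w.+1) (2 ^+ 0)).
  rewrite modulus_fourier// mulVKf ?gt_eqF//.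
  rewrite -opprB -sum_turn_sin_weight_class; apply: le_trans (Im_le _).
  rewrite /char_sum (big_morph (@complex.Im R) (id1 := 0) (op1 := +%R))//; last by case=> a b [].
  rewrite -sumrN; apply: ler_sum => x _.
  by rewrite /character val1 /= sinN mulr1 lexx.
have nw : 0 <= (n - w.+1)%:R :> R by [].
apply: le_trans (ler_wpM2l nw gap).
rewrite mulrBr; have := shifted_sines_ge; have := upper_sines_ge.
have : (n - w.+1)%:R = n%:R - w.+1%:R :> R by rewrite natrB// ltnW// ltnS.
have : n%:R <= 2 * w.+1%:R :> R by rewrite -natrM ler_nat.
move: (n - w.+1)%:R => d n2 -> T S; nra.
Qed.

End SineGap.

(** * Binomial coefficients near the middle *)

Section Binomials.

Lemma central_binS h : (h.+1 * 'C(h.+1.*2, h.+1) = 2 * h.*2.+1 * 'C(h.*2, h))%N.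
Proof.
rewrite doubleS; have := mul_bin_diag h.*2.+2 h; have := mul_bin_down h.*2.+1 h.
by rewrite /= => ? ?; have := addnn h; nia.
Qed.

Lemma central_bin_ge h : (0 < h)%N -> (16 ^ h <= 4 * h * 'C(h.*2, h) ^ 2)%N.
Proof.
case: h => // h _; elim: h => [|h IH] //.
have e := central_binS h.+1; move: IH e.
set B := 'C(h.+1.*2, h.+1); set B' := 'C(h.+2.*2, h.+2) => IH e.
have h0 : (0 < h.+2)%N by [].
rewrite -(leq_pmul2l h0) expnS.
have -> : (h.+2 * (4 * h.+2 * B' ^ 2) = 4 * (h.+2 * B') ^ 2)%N by ring.
rewrite e; apply: (leq_trans (leq_mul (leqnn _) (leq_mul (leqnn 16) IH))).
have -> : (h.+2 * (16 * (4 * h.+1 * B ^ 2)) = 64 * (h.+2 * h.+1) * B ^ 2)%N by ring.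
have -> : (4 * (2 * h.+1.*2.+1 * B) ^ 2 = 16 * h.+1.*2.+1 ^ 2 * B ^ 2)%N by ring.
rewrite leq_mul2r; apply/orP; right; rewrite -muln2; nia.
Qed.

Lemma half_bin_ge M : (1 < M)%N -> (4 ^ M <= 8 * M * 'C(M, M./2) ^ 2)%N.
Proof.
move=> M1; have := central_bin_ge (_ : 0 < M./2)%N.
have h0 : (0 < M./2)%N by case: M M1 => [|[]].
move=> /(_ h0); have ME := odd_double_half M.
have e16 : (16 ^ M./2 = 4 ^ (M./2).*2)%N by rewrite -muln2 mulnC expnM.
have mono : ('C((M./2).*2, M./2) <= 'C(M, M./2))%N.
  by rewrite leq_bin2l// -[leqRHS]ME leq_addl.
rewrite e16 => h.
have {}h : (4 ^ (M./2).*2 <= 4 * M./2 * 'C(M, M./2) ^ 2)%N.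
  by apply: (leq_trans h); rewrite leq_mul2l leq_sqr mono orbT.
have -> : (4 ^ M = 4 ^ odd M * 4 ^ (M./2).*2)%N by rewrite -expnD ME.
have o4 : (4 ^ odd M <= 4)%N by case: odd.
have M2 : (M./2 + M./2 <= M)%N by rewrite addnn -[leqRHS]ME leq_addl.
apply: (leq_trans (leq_mul o4 h)).
by rewrite !mulnA leq_mul2r; apply/orP; right; lia.
Qed.

Lemma mul_bin_two_steps m k :
  (k.+1 * (m.+1 - k) * 'C(m.+2, k.+1) = m.+2 * m.+1 * 'C(m, k))%N.
Proof.
have := mul_bin_diag m.+2 k; have := mul_bin_down m.+1 k.
by move=> /= e1 e2; rewrite mulnAC -e2 -!mulnA e1; congr (_ * _)%N; rewrite mulnC.
Qed.

Variable R : realType.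

(** The hypothesis bounds the ratios of consecutive binomial coefficients
    between h and h + j. *)
Lemma bin_shift_le M h j (q : R) : 0 <= q ->
  (forall i, (h <= i < h + j)%N -> (i < M)%N /\ i.+1%:R <= (1 + q) * (M - i)%:R) ->
  'C(M, h)%:R <= (1 + q) ^+ j * 'C(M, h + j)%:R.
Proof.
move=> q0; elim: j => [|j IH] hq; first by rewrite addn0 expr0 mul1r.
have hj i : (h <= i < h + j)%N -> (i < M)%N /\ i.+1%:R <= (1 + q) * (M - i)%:R.
  by move=> /andP[hi ij]; apply: hq; rewrite hi addnS leqW.
apply: (le_trans (IH hj)).
have qj : 0 <= (1 + q) ^+ j by rewrite exprn_ge0// addr_ge0.
rewrite exprSr -mulrA; apply: ler_wpM2l => //.
have hjj : (h <= h + j < h + j.+1)%N by rewrite leq_addr addnS ltnSn.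
have [iM le] := hq _ hjj.
have d0 : 0 < (h + j).+1%:R :> R by rewrite ltr0n.
have := mul_bin_left M (h + j); move/(congr1 (fun k => k%:R : R)); rewrite !natrM => e.
rewrite addnS -(ler_pM2l d0) mulrCA e mulrA.
by rewrite ler_wpM2r.
Qed.

End Binomials.

(** * Lower bound for the fourth moment *)

Section LowerBound.
Variables (R : realType) (n : nat).
Hypothesis n_ge5 : (5 <= n)%N.
Local Notation N := (mersenne n).
Local Notation w := (shifted_weight R n).
Local Notation x := (Num.sqrt n%:R : R).

Lemma sqrt_sqr : x ^+ 2 = n%:R.
Proof. by rewrite sqr_sqrtr. Qed.

Lemma shifted_weight_bounds : n%:R / 2 + x - 1 < w%:R <= n%:R / 2 + x.
Proof.
set y := n%:R / 2 + x; have y0 : 0 <= y by rewrite addr_ge0 ?divr_ge0 ?sqrtr_ge0.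
have wE : w%:R = (Num.floor y)%:~R :> R.
  by rewrite /shifted_weight -/y pmulrn gez0_abs// floor_ge0.
rewrite wE floor_le andbT; have := floorD1_gt y.
by rewrite rmorphD /=; lra.
Qed.

Lemma sqrt_gt2 : 2 < x.
Proof.
have := sqrt_sqr; have : 5 <= n%:R :> R by rewrite (ler_nat R 5).
by have := sqrtr_ge0 (n%:R : R); nra.
Qed.

Lemma shifted_weight_lt : (w < n)%N.
Proof.
have /andP[_ hw] := shifted_weight_bounds; have x2 := sqrt_gt2; have xn := sqrt_sqr.
rewrite -(ltr_nat R); have : 0 < x * (x - 2) by rewrite mulr_gt0 ?subr_gt0//; lra.
by rewrite mulrBr -expr2 xn; lra.
Qed.

Lemma shifted_weight_gt0 : (0 < w)%N.
Proof.
have /andP[hw _] := shifted_weight_bounds; have x2 := sqrt_gt2.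
by rewrite -(ltr_nat R); have := ler0n R n; lra.
Qed.

Hypothesis x_large : 130 <= x.

(** Between the middle and w consecutive coefficients have ratio at most
    1 + 8 / sqrt n, over at most 2 sqrt n steps: a bounded factor exp 16 away
    from the central coefficient, which is of order 2^n / sqrt n. *)
Lemma binomial_near_middle_ge :
  2 ^+ n <= 24 * expR 16 * x * 'C(n - 3, w.-1)%:R.
Proof.
have /andP[hw1 hw2] := shifted_weight_bounds; have xn := sqrt_sqr.
have w0 := shifted_weight_gt0; have xl := x_large.
have n3 : (3 <= n)%N by rewrite (leq_trans _ n_ge5).
set M := (n - 3)%N; set h := M./2.
have ME : M%:R = n%:R - 3 :> R by rewrite natrB.
have hM : h%:R * 2 <= M%:R :> R.
  by rewrite -natrM ler_nat muln2 -[leqRHS]odd_double_half leq_addl.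
have hM' : M%:R <= h%:R * 2 + 1 :> R.
  rewrite -natrM natr1 ler_nat muln2 -[leqLHS]odd_double_half -addn1 addnC leq_add2l.
  by case: odd.
have w1 : w.-1%:R + 1 = w%:R :> R by rewrite natr1 prednK.
have hw : (h <= w.-1)%N by rewrite -(ler_nat R); lra.
set j := (w.-1 - h)%N.
have hj : (h + j)%N = w.-1 by rewrite subnKC.
have jE : j%:R = w.-1%:R - h%:R :> R by rewrite natrB.
have x0 : 0 < x by lra.
have xx : 130 * x <= x ^+ 2 by rewrite expr2 ler_wpM2r// ltW.
rewrite xn in xx.
set q := 8 / x.
have q0 : 0 <= q by rewrite divr_ge0// ltW.
have qx : q * x = 8 by rewrite /q divfK// gt_eqF.
have step i : (h <= i < h + j)%N -> (i < M)%N /\ i.+1%:R <= (1 + q) * (M - i)%:R.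
  rewrite hj => /andP[_ iw].
  have iw' : i%:R + 1 <= w.-1%:R :> R by rewrite natr1 ler_nat.
  have iM : (i < M)%N by rewrite -(ltr_nat R); lra.
  split=> //; rewrite natrB ?(ltnW iM)// -natr1.
  have Mi : x ^+ 2 / 4 <= M%:R - i%:R by rewrite xn; lra.
  have : q * (x ^+ 2 / 4) <= q * (M%:R - i%:R) by rewrite ler_wpM2l.
  have -> : q * (x ^+ 2 / 4) = 2 * x by rewrite expr2 mulrA mulrA qx; field.
  lra.
have := bin_shift_le q0 step; rewrite hj.
have e16 : (1 + q) ^+ j <= expR 16.
  apply: (@le_trans _ _ (expR q ^+ j)).
    by apply: lerXn2r; rewrite ?nnegrE ?expR_ge0 ?expR_ge1Dx// addr_ge0.
  rewrite -expRM_natl ler_expR; have : j%:R <= 2 * x by lra.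
  by move=> j2; have := ler_wpM2r q0 j2; lra.
have C0 : 0 <= 'C(M, w.-1)%:R :> R by [].
move=> le1; have {}le1 := le_trans le1 (ler_wpM2r C0 e16).
have M1 : (1 < M)%N by rewrite -(ltr_nat R); lra.
have := half_bin_ge M1; rewrite -/h -(ler_nat R) natrX (natrM R (8 * M)) (natrM R 8) (natrX R).
set B := 'C(M, h)%:R in le1 *; set D := 'C(M, w.-1)%:R in le1 C0 *.
have B0 : 0 <= B by [].
have -> : 4%:R ^+ M = (2 ^+ M) ^+ 2 :> R by rewrite -exprM mulnC exprM; congr (_ ^+ M); rewrite -natrX.
have -> : 2 ^+ n = 8 * 2 ^+ M :> R.
  by rewrite -[in LHS](subnK n3) exprD mulrC; congr (_ * _); ring.
have p0 : 0 < 2 ^+ M :> R by rewrite exprn_gt0.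
move: (2 ^+ M) p0 => P P0 PB.
have P3 : P <= 3 * (x * B).
  have b0 : 0 <= 3 * (x * B) by rewrite !mulr_ge0// ltW.
  rewrite -(ler_pXn2r (_ : 0 < 2)%N) ?nnegrE ?(ltW P0)//.
  apply: (le_trans PB); rewrite !exprMn xn ME mulrA.
  rewrite (_ : 3 ^+ 2 = 9 :> R); last by ring.
  by rewrite ler_wpM2r ?sqr_ge0//; have := ler0n R n; lra.
have := ler_wpM2l (ltW x0) le1; lra.
Qed.

(** In modulus_fourier_unit_ge the coefficient 2 w - n is about 2 sqrt n, so
    the main term is of order sqrt n times 'C(n - 3, w - 1), while the error
    is bounded by a constant times that binomial coefficient. *)
Lemma modulus_fourier_unit_lower :
  (96 * expR 16)^-1 / n%:R <= modulus (fourier R (weight_class n w) (2 ^+ 0)).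
Proof.
have /andP[hw1 hw2] := shifted_weight_bounds; have xn := sqrt_sqr.
have w0 := shifted_weight_gt0; have xl := x_large; have wn := shifted_weight_lt.
have x0 : 0 < x by lra.
have xx : 130 * x <= x ^+ 2 by rewrite expr2 ler_wpM2r// ltW.
rewrite xn in xx.
have n2w : (n <= 2 * w)%N by rewrite -(ler_nat R) natrM; lra.
have [m nE] : {m | n = m.+3} by exists (n - 3)%N; lia.
have [k wE] : {k | w = k.+1} by exists w.-1; rewrite prednK.
have e16 : 0 < expR 16 :> R by exact: expR_gt0.
have mid := binomial_near_middle_ge.
have bins := mul_bin_two_steps m k.
have gap := @modulus_fourier_unit_ge R m k.
rewrite -nE -wE in gap; rewrite -wE in bins.
have wm : (w <= m.+2)%N by move: wn; rewrite nE ltnS.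
have {}gap := gap wm n2w.
have mE : m = (n - 3)%N by rewrite nE -addn3 addnK.
have kE : k = w.-1 by rewrite wE.
rewrite -mE -kE in mid.
have N0 := mersenne_pos R (leq_trans (isT : 1 < 5)%N n_ge5).
set mu := modulus _ in gap *.
have n0 : 0 < n%:R :> R by rewrite ltr0n (leq_trans _ n_ge5).
have mu0 : 0 <= mu by exact: normc_nonneg.
set D := 'C(m, k)%:R in gap mid.
have D0 : 0 <= D by rewrite ler0n.
have CD : 'C(m.+2, w)%:R <= 8 * D.
  have /(congr1 (fun i => i%:R : R)) := bins; rewrite !natrM -/D.
  have -> : (m.+1 - k)%:R = n%:R - 1 - w%:R :> R.
    have n1 : (n - 1)%N = m.+2 by rewrite nE subn1.
    have -> : (m.+1 - k)%N = (n - 1 - w)%N by rewrite n1 wE subSS.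
    by rewrite !natrB ?n1// (leq_trans _ n_ge5).
  have -> : m.+2%:R = n%:R - 1 :> R by rewrite nE -[in RHS]natr1 addrK.
  have -> : m.+1%:R = n%:R - 2 :> R by rewrite nE -2![in RHS]natr1; ring.
  have C0 : 0 <= 'C(m.+2, w)%:R :> R by [].
  move: ('C(m.+2, w)%:R : R) C0 => C C0 e.
  have le1 : n%:R ^+ 2 / 8 <= w%:R * (n%:R - 1 - w%:R) :> R.
    have -> : n%:R ^+ 2 / 8 = n%:R / 2 * (n%:R / 4) :> R by field.
    by apply: ler_pM; rewrite ?divr_ge0//; lra.
  have le2 := ler_wpM2r C0 le1; rewrite e in le2.
  have le3 : (n%:R - 1) * (n%:R - 2) * D <= n%:R ^+ 2 * D by rewrite ler_wpM2r// expr2; nra.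
  have n2 : 0 < n%:R ^+ 2 :> R by rewrite exprn_gt0.
  rewrite -(ler_pM2l n2); lra.
have pi4 : pi <= 4 :> R by have := pihalf_lt2 R; lra.
have pi0 := pi_ge0 R.
have wn' : (n - w)%:R <= n%:R :> R by rewrite ler_nat leq_subr.
have Nmu0 : 0 <= N%:R * mu by rewrite mulr_ge0// ltW.
have up : x / 4 * D <= n%:R * (N%:R * mu).
  apply: le_trans (ler_wpM2r Nmu0 wn'); apply: le_trans gap.
  have a1 : pi * 'C(m.+2, w)%:R <= 4 * (8 * D) by apply: ler_pM.
  have a2 : (x - 1) / 2 * D <= (2 * w%:R - n%:R) / 4 * D by rewrite ler_wpM2r//; lra.
  have a3 : 130 * D <= x * D by rewrite ler_wpM2r.
  lra.
have NP : N%:R <= 2 ^+ n :> R by rewrite -(mersenne_natr R n) lerDl.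
rewrite ler_pdivrMr// -(ler_pM2l N0).
have Nle : N%:R * (96 * expR 16)^-1 <= x / 4 * D.
  by rewrite ler_pdivrMr ?mulr_gt0//; apply: (le_trans NP); apply: (le_trans mid); lra.
by apply: (le_trans Nle); apply: (le_trans up); lra.
Qed.

Lemma sum_fourier4_ge :
  (96 * expR 16) ^- 4 * n%:R ^- 3 <=
  \sum_(t : residue n | t != 0) modulus (fourier R (weight_class n w) t) ^+ 4.
Proof.
have n_gt1 : (1 < n)%N by rewrite (leq_trans _ n_ge5).
have wn := shifted_weight_lt.
have n0 : 0 < n%:R :> R by rewrite ltr0n ltnW.
have e0 : 0 < 96 * expR 16 :> R by rewrite mulr_gt0// expR_gt0.
pose pw (i : 'I_n) : residue n := 2 ^+ i.
have pw_inj : injective pw.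
  move=> i j /(congr1 (@nat_of_ord _)); rewrite /pw !val_pow2// => e.
  by apply/val_inj/(@expnI 2).
have m0 t : 0 <= modulus (fourier R (weight_class n w) t) ^+ 4.
  by rewrite exprn_ge0// normc_nonneg.
apply: (@le_trans _ _ (\sum_(t in [set pw i | i : 'I_n])
    modulus (fourier R (weight_class n w) t) ^+ 4)); last first.
  rewrite [leRHS](bigID (mem [set pw i | i : 'I_n])) /= -[leLHS]addr0 lerD ?sumr_ge0//.
  rewrite le_eqVlt; apply/orP; left; apply/eqP; apply: eq_bigl => t.
  case: (boolP (t \in _)) => [/imsetP[i _ ->]|]; rewrite ?andbF// andbT.
  by rewrite -val_eqE /= val_pow2// -lt0n expn_gt0.
rewrite big_imset /=; last by move=> i j _ _; exact: pw_inj.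
under eq_bigr do rewrite fourier_rotate//.
rewrite sumr_const card_ord -(mulr_natl (_ ^+ 4)).
have mu := modulus_fourier_unit_lower.
have mu4 : ((96 * expR 16)^-1 / n%:R) ^+ 4 <=
    modulus (fourier R (weight_class n w) (2 ^+ 0)) ^+ 4.
  have a0 : 0 <= (96 * expR 16)^-1 / n%:R :> R by rewrite divr_ge0// invr_ge0 ltW.
  by apply: lerXn2r => //; rewrite nnegrE// normc_nonneg.
apply: le_trans (ler_wpM2l (ltW n0) mu4).
rewrite le_eqVlt; apply/orP; left; apply/eqP.
move: (96 * expR 16) e0 (n%:R) n0 => c c0 y y0; field.
by rewrite !gt_eqF.
Qed.

End LowerBound.

(** * Conclusion *)

Section Conclusion.
Variable R : realType.

Definition fourth_moment n : R := \sum_(t : residue n | t != 0)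
  modulus (fourier R (weight_class n (shifted_weight R n)) t) ^+ 4.

(** The residue 0 is not in the weight class, and the class is not empty. *)
Lemma fourth_moment_gt0 n : (5 <= n)%N -> 0 < fourth_moment n.
Proof.
move=> n5; have n_gt1 : (1 < n)%N by rewrite (leq_trans _ n5).
have w0 := shifted_weight_gt0 R n5; have wn := shifted_weight_lt R n5.
apply: (@fourier4_pos _ _ n_gt1 _ 0).
  have wt0 : wt (0 : residue n) = 0%N.
    by apply: eq_card0 => i; rewrite !inE div0n.
  by rewrite inE wt0 eq_sym -lt0n.
have := sum_weight_class n_gt1 (fun=> 1%N) wn.
rewrite sum1_card => ->; rewrite sum1dep_card card_draws card_ord bin_gt0.
exact: ltnW.
Qed.

(** Large n are covered by sum_fourier4_ge; the finitely many others only need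
    positivity. *)
Lemma fourth_moment_ge : exists2 c : R, 0 < c &
  forall n, (5 <= n)%N -> c <= fourth_moment n * n%:R ^+ 3.
Proof.
apply: (@uniform_lower_bound _ _ 5 (130 ^ 2)%N ((96 * expR 16) ^- 4)).
- by rewrite invr_gt0 exprn_gt0// mulr_gt0// expR_gt0.
- move=> n n5; rewrite mulr_gt0 ?fourth_moment_gt0// exprn_gt0// ltr0n.
  exact: leq_trans n5.
- move=> n n5 n130; have x_large : 130 <= Num.sqrt n%:R :> R.
    by rewrite -[130]ger0_norm// -sqrtr_sqr ler_sqrt// -natrX ler_nat.
  have := sum_fourier4_ge n5 x_large; rewrite ler_pdivrMr//.
  by rewrite exprn_gt0// ltr0n; exact: leq_trans n5.
Qed.

End Conclusion.

Theorem theorem4 (R : realType) :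
  (exists c : R, 0 < c /\
     forall n : nat, (5 <= n)%N ->
       c * n%:R ^- 3 <=
       \sum_(t : residue n | t != 0)
          modulus (fourier R (weight_class n (shifted_weight R n)) t) ^+ 4)
  /\
  (exists c1 c2 : R, 0 < c1 /\ c1 <= c2 /\
     forall n : nat, (5 <= n)%N ->
       let N : R := (mersenne n)%:R in
       let S := weight_class n (shifted_weight R n) in
       let excess : R := (energy S)%:R - #|S|%:R ^+ 4 / N in
       c1 * N ^+ 3 * n%:R ^- 3 <= excess /\
       excess <= c2 * N ^+ 3 * n%:R ^- 3).
Proof.
have [c c0 lower] := fourth_moment_ge R.
have low n : (5 <= n)%N -> c * n%:R ^- 3 <= fourth_moment R n.
  move=> n5; rewrite ler_pdivrMr ?lower// exprn_gt0// ltr0n.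
  exact: leq_trans n5.
split; first by exists c.
set C := 2 ^+ 18 * spectral_const R.
have up n : (5 <= n)%N -> fourth_moment R n <= C * n%:R ^- 3.
  by move=> n5; exact: sum_fourier4_le n5 _ (shifted_weight_lt R n5).
have cC : c <= C.
  have := le_trans (low 5%N isT) (up 5%N isT).
  by rewrite ler_pM2r// invr_gt0 exprn_gt0// ltr0n.
exists c, C; split=> //; split=> // n n5 /=.
have n_gt1 : (1 < n)%N by rewrite (leq_trans _ n5).
rewrite (energy_excess _ n_gt1) -/(fourth_moment R n).
have N3 : 0 <= (mersenne n)%:R ^+ 3 :> R by rewrite exprn_ge0.
have scale (a : R) : a * (mersenne n)%:R ^+ 3 * n%:R ^- 3 =
  (mersenne n)%:R ^+ 3 * (a * n%:R ^- 3) by rewrite mulrAC mulrC.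
rewrite !scale; split; apply: ler_wpM2l => //; first exact: low.
exact: up.
Qed.
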